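(* Consider the system on $\mathbb{R}^2$ $$\dot x_1=x_2,\qquad \dot x_2=-\sigma_1(t/\alpha)x_2-k(t)x_1-\left\{\sigma_2(t/\alpha)+\sigma_3(t/\alpha)e^{-\beta_1\mu(x_2)}\right\}\tanh(\beta_2x_2), \tag{F}$$ where $\alpha>0$ is a constant, $\beta_1,\beta_2>0$ are constants, and: - $\sigma_i:\mathbb{R}\to(0,1]$, $i=1,2,3$, are $C^1$ functions with bounded derivatives; - $k:[0,\infty)\to(0,\infty)$ is $C^1$ with bounded derivative, and there are constants $k_o,\bar k>0$ such that $k_o\le k(t)\le\bar k$ and $k'(t)\le0$ for all $t\ge0$; - $\mu:\mathbb{R}\to[0,\infty)$ is zero only at zero and has a globally bounded derivative; - there exist constants $c_b,T>0$ such that $\int_{t-T}^t\sigma_1(r)\,dr\ge c_b$ for all $t\ge0$. Set $$A=1+\frac{k_o}{2}+\frac{(1+2\beta_2)^2}{k_o},\qquad V(x,t,\tau)=A\left(k(t)x_1^2+x_2^2\right)+\tau_1x_1x_2\quad\text{for }\tau=(\tau_1,\tau_2,\tau_3),$$ $\bar b=k_o/(4A^2\bar k)$ and $p(t)=(\sigma_1(t),\sigma_2(t),\sigma_3(t))$. Then there exists a constant $\alpha_o>0$ such that for all constants $\alpha>\alpha_o$, the system (F) is UGAS and admits the Lyapunov function $$V_\alpha(x,t):=V(x,t,p(t/\alpha))\,\exp\left(\frac{\alpha\bar b}{T}\int_{\frac t\alpha-T}^{\frac t\alpha}\int_s^{\frac t\alpha}\sigma_1(l)\,dl\,ds\right)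.$$
   Context: $|\cdot|$ is the Euclidean norm; subscripts on $W$ below denote partial gradients; $C^1$ means continuously differentiable (one-sided at the endpoint $0$ of $[0,\infty)$). $\mathcal{K}_\infty$: continuous, strictly increasing, unbounded functions $\rho:[0,\infty)\to[0,\infty)$ with $\rho(0)=0$. $\mathcal{KL}$: continuous functions $\beta:[0,\infty)\times[0,\infty)\to[0,\infty)$ such that $\beta(\cdot,t)\in\mathcal{K}_\infty$ for each $t\ge0$, $\beta(s,\cdot)$ is non-increasing for each $s\ge0$, and $\beta(s,t)\to0$ as $t\to+\infty$ for each $s\ge 0$. A continuous function $\rho:[0,\infty)\to[0,\infty)$ is positive definite if it is zero only at zero. For a system $\dot x=h(x,t)$ on $\mathbb{R}^n$, $t\ge0$, with trajectories $\phi(t;t_o,x_o)$ (value $x_o$ at time $t_o$): - It is UGAS if there is $\beta\in\mathcal{KL}$ with $|\phi(t;t_o,x_o)|\le\beta(|x_o|,t-t_o)$ for all $x_o\in\mathbb{R}^n$, $t_o\ge0$, $t\ge t_o$. - A Lyapunov function for it is a $C^1$ function $W:\mathbb{R}^n\times[0,\infty)\to[0,\infty)$ for which there are $\alpha_1,\alpha_2\in\mathcal{K}_\infty$ and a positive definite $\alpha_3$ such that $\alpha_1(|x|)\le W(x,t)\le\alpha_2(|x|)$ and $W_t(x,t)+W_x(x,t)h(x,t)\le-\alpha_3(|x|)$ for all $t\ge0$, $x\in\mathbb{R}^n$. *)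

(* Defs.v *)
(* Stdlib reals with Coquelicot. *)
From Stdlib Require Import Reals.
From Coquelicot Require Import Coquelicot.
Open Scope R_scope.

(** A function on [[0,∞)] is represented by a function on [R] of which only the
    values at nonnegative arguments are ever constrained.  The state space
    [R^2] is [R * R]; Coquelicot's product norm there is
    [sqrt (|x1|^2 + |x2|^2)], so [norm x] is the Euclidean norm. *)

Definition nonneg (t : R) : Prop := 0 <= t.

Definition dot (u v : R * R) : R := fst u * fst v + snd u * snd v.

(** Derivative relative to a set [D]: for [D] an interval it is the usual
    derivative at interior points and the one-sided one at endpoints in [D]. *)
Definition is_derive_within {V : NormedModule R_AbsRing}
    (D : R -> Prop) (f : R -> V) (t : R) (l : V) : Prop :=
  filterdiff f (within D (locally t)) (fun y : R => scal y l).

Definition C1_bounded_derivative (f : R -> R) : Prop :=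
  (forall t, ex_derive f t) /\
  (forall t, continuous (Derive f) t) /\
  (exists M, forall t, Rabs (Derive f t) <= M).

Definition C1_halfline (f df : R -> R) : Prop :=
  (forall t, nonneg t -> is_derive_within nonneg f t (df t)) /\
  continuous_on nonneg df.

Definition class_Kinf (rho : R -> R) : Prop :=
  (forall s, 0 <= s -> 0 <= rho s) /\
  continuous_on nonneg rho /\
  (forall s r, 0 <= s -> s < r -> rho s < rho r) /\
  (forall M, exists s, 0 <= s /\ M < rho s) /\
  rho 0 = 0.

Definition class_KL (beta : R -> R -> R) : Prop :=
  continuous_on (fun q : R * R => 0 <= fst q /\ 0 <= snd q)
    (fun q : R * R => beta (fst q) (snd q)) /\
  (forall s t, 0 <= s -> 0 <= t -> 0 <= beta s t) /\
  (forall t, 0 <= t -> class_Kinf (fun s => beta s t)) /\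
  (forall s t r, 0 <= s -> 0 <= t -> t <= r -> beta s r <= beta s t) /\
  (forall s, 0 <= s -> is_lim (beta s) p_infty 0).

Definition positive_definite (rho : R -> R) : Prop :=
  (forall s, 0 <= s -> 0 <= rho s) /\
  continuous_on nonneg rho /\
  (forall s, 0 <= s -> (rho s = 0 <-> s = 0)).

(** [phi] solves [x' = h(x,t)] on [[to,∞)] with value [xo] at time [to]. *)
Definition is_trajectory (h : R * R -> R -> R * R) (to : R) (xo : R * R)
    (phi : R -> R * R) : Prop :=
  phi to = xo /\
  forall t, to <= t ->
    is_derive_within (fun s => to <= s) phi t (h (phi t) t).

(** The existence clause makes the estimate non-vacuous: writing
    [phi(t;to,xo)] for all [t >= to] presupposes forward completeness. *)
Definition UGAS (h : R * R -> R -> R * R) : Prop :=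
  exists beta : R -> R -> R, class_KL beta /\
    forall (xo : R * R) (to : R), 0 <= to ->
      (exists phi, is_trajectory h to xo phi) /\
      (forall phi, is_trajectory h to xo phi ->
         forall t, to <= t -> norm (phi t) <= beta (norm xo) (t - to)).

(** [W] is [C^1] on [R^2 x [0,∞)], with partial gradients [Wx] and [Wt]:
    Fréchet differentiable relative to that set, with continuous differential. *)
Definition C1_state_time (W : R * R -> R -> R)
    (Wx : R * R -> R -> R * R) (Wt : R * R -> R -> R) : Prop :=
  let D := fun q : (R * R) * R => 0 <= snd q in
  (forall x t, 0 <= t ->
     filterdiff (fun q : (R * R) * R => W (fst q) (snd q))
       (within D (locally ((x, t) : (R * R) * R)))
       (fun v : (R * R) * R => dot (Wx x t) (fst v) + Wt x t * snd v)) /\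
  continuous_on D (fun q : (R * R) * R => Wx (fst q) (snd q)) /\
  continuous_on D (fun q : (R * R) * R => Wt (fst q) (snd q)).

Definition is_Lyapunov (h : R * R -> R -> R * R) (W : R * R -> R -> R) : Prop :=
  (forall x t, 0 <= t -> 0 <= W x t) /\
  exists (Wx : R * R -> R -> R * R) (Wt : R * R -> R -> R)
         (alpha1 alpha2 alpha3 : R -> R),
    C1_state_time W Wx Wt /\
    class_Kinf alpha1 /\ class_Kinf alpha2 /\ positive_definite alpha3 /\
    forall x t, 0 <= t ->
      alpha1 (norm x) <= W x t <= alpha2 (norm x) /\
      Wt x t + dot (Wx x t) (h x t) <= - alpha3 (norm x).

Definition friction_field (sigma1 sigma2 sigma3 k mu : R -> R)
    (beta1 beta2 alpha : R) (x : R * R) (t : R) : R * R :=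
  let (x1, x2) := x in
  (x2,
   - sigma1 (t / alpha) * x2 - k t * x1
   - (sigma2 (t / alpha) + sigma3 (t / alpha) * exp (- beta1 * mu x2))
     * tanh (beta2 * x2)).

Definition A_const (ko beta2 : R) : R :=
  1 + ko / 2 + (1 + 2 * beta2) ^ 2 / ko.

Definition b_bar (ko kbar beta2 : R) : R :=
  ko / (4 * (A_const ko beta2) ^ 2 * kbar).

Definition V_frozen (A : R) (k : R -> R) (x : R * R) (t : R) (tau : R * R * R)
    : R :=
  let (x1, x2) := x in
  let '(tau1, tau2, tau3) := tau in
  A * (k t * x1 ^ 2 + x2 ^ 2) + tau1 * x1 * x2.

Definition V_alpha (sigma1 sigma2 sigma3 k : R -> R) (ko kbar beta2 T alpha : R)
    (x : R * R) (t : R) : R :=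
  let p := fun r => (sigma1 r, sigma2 r, sigma3 r) in
  V_frozen (A_const ko beta2) k x t (p (t / alpha)) *
  exp (alpha * b_bar ko kbar beta2 / T *
       RInt (fun s => RInt sigma1 s (t / alpha)) (t / alpha - T) (t / alpha)).

(* Main.v *)
(** Along (F) the frozen function [V] satisfies [V' <= (|sigma1'|/alpha - b sigma1) V],
    because [V] is quadratic with [|x|^2/2 <= V <= 2 A^2 kbar |x|^2] and the cross
    terms are absorbed by Young's inequality; the term [k' x1^2] only helps.
    With [r = t/alpha], the double integral has derivative
    [T sigma1(r) - int_{r-T}^r sigma1], so the exponential factor trades
    the decay rate [b sigma1], which may vanish in the limit, for its average, at
    least [b cb/T].  For [alpha] large, [V_alpha' <= - (b cb/(2T)) V_alpha], so
    that solutions decay exponentially.  Forward completeness holds because the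
    field is globally Lipschitz: [mu] is nonnegative and Lipschitz, hence
    [exp(- beta1 mu)] and its product with [tanh] are Lipschitz. *)

Require Import Defs.
From Stdlib Require Import Reals Lra.
From Coquelicot Require Import Coquelicot.
Open Scope R_scope.

(** * Global solutions of Lipschitz differential equations *)

(** At each time [V_alpha] is a quadratic form in the state, with coefficients [A * k], [A] and
    [sigma1], all multiplied by the exponential weight. Stability and the Lyapunov property are
    therefore derived once, for forms with arbitrary differentiable coefficients. The cross term of
    [V] carries [sigma1] because its derivative supplies the only damping of [x1], namely
    [- sigma1 k x1^2]. Viscous damping of [x2] is weighted by [sigma1] too, so one bracket factors
    through [sigma1], and its negativity gives the rate [b sigma1]. The [tanh] friction counts by
    its sign against [A x2] and by its size in the cross term. In that bracket [|x1||x2|] has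
    coefficient [1 + 2 beta2]: 1 from viscous friction, [2 beta2] from [tanh]. The last summand of
    [A] pays for it. The gain [k] and the trajectories have only one-sided derivatives at their
    initial times. Both are continued affinely to the left, after which ordinary two-sided calculus
    applies. *)

Lemma exp_le_compat (x y : R) : x <= y -> exp x <= exp y.
Proof.
  intros [H| ->]; [left; apply exp_increasing; assumption|right; reflexivity].
Qed.

Lemma norm_minus_triangle {K : AbsRing} {V : NormedModule K} (x y z : V) :
  norm (minus x z) <= norm (minus x y) + norm (minus y z).
Proof.
  replace (minus x z) with (plus (minus x y) (minus y z)).
  - apply norm_triangle.
  - unfold minus. rewrite <- plus_assoc, (plus_assoc (opp y)), plus_opp_l,
      plus_zero_l. reflexivity.
Qed.

Lemma minus_plus_r {G : AbelianGroup} (x y : G) : minus (plus x y) x = y.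
Proof.
  unfold minus. rewrite (plus_comm x y), <- (plus_assoc y x), plus_opp_r.
  apply plus_zero_r.
Qed.

Lemma minus_plus_l {G : AbelianGroup} (x y z : G) :
  minus (plus x y) (plus x z) = minus y z.
Proof.
  unfold minus at 1. rewrite opp_plus, (plus_assoc (plus x y) (opp x)).
  change (plus (minus (plus x y) x) (opp z) = minus y z).
  rewrite minus_plus_r. reflexivity.
Qed.

Lemma norm_minus_diag {K : AbsRing} {V : NormedModule K} (x : V) :
  norm (minus x x) = 0.
Proof. rewrite minus_eq_zero. apply (norm_zero (V := V)). Qed.

Lemma norm_minus_sym {K : AbsRing} {V : NormedModule K} (x y : V) :
  norm (minus x y) = norm (minus y x).
Proof. rewrite <- norm_opp, opp_minus. reflexivity. Qed.

(** The increment is split at [h (phi t) s]: the Lipschitz bound, uniform in time, controls the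
    change of state, and continuity in time at the fixed state [phi t] controls the rest. *)
Lemma continuous_lipschitz_comp {V : NormedModule R_AbsRing}
  (h : V -> R -> V) (L : R) (phi : R -> V) (t : R) :
  0 < L ->
  (forall x y s, norm (minus (h x s) (h y s)) <= L * norm (minus x y)) ->
  (forall x s, continuous (h x) s) ->
  continuous phi t -> continuous (fun s => h (phi s) s) t.
Proof.
  intros HL Hlip Hc Hphi.
  apply filterlim_locally_ball_norm. intros eps.
  assert (He : 0 < eps / 2) by (destruct eps; simpl; lra).
  assert (HeL : 0 < eps / 2 / L) by (apply Rdiv_lt_0_compat; lra).
  pose proof (proj1 (filterlim_locally_ball_norm _ _) Hphi (mkposreal _ HeL)) as H1.
  pose proof (proj1 (filterlim_locally_ball_norm _ _) (Hc (phi t) t) (mkposreal _ He)) as H2.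
  generalize (filter_and _ _ H1 H2).
  apply filter_imp. intros s [G1 G2]. unfold ball_norm in *. simpl in G1, G2.
  eapply Rle_lt_trans; [apply (norm_minus_triangle _ (h (phi t) s))|].
  pose proof (Hlip (phi s) (phi t) s) as G3.
  apply (Rmult_lt_compat_l L) in G1; [|assumption].
  replace (L * (eps / 2 / L)) with (eps / 2) in G1 by (field; lra).
  lra.
Qed.

(** Integrating the exponential weight gains the factor [1 / c], which is the source of the
    contraction; the value at the lower limit is nonnegative and dropped. *)
Lemma norm_RInt_exp_le {V : CompleteNormedModule R_AbsRing} (f : R -> V)
  (B c t0 t : R) :
  0 < c -> 0 <= B -> t0 <= t -> (forall s, continuous f s) ->
  (forall s, t0 <= s <= t -> norm (f s) <= B * exp (c * (s - t0))) ->
  norm (RInt f t0 t) <= B / c * exp (c * (t - t0)).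
Proof.
  intros Hc HB Ht Hf Hb.
  apply Rle_trans with (B / c * exp (c * (t - t0)) - B / c * exp (c * (t0 - t0))).
  - apply (norm_RInt_le f (fun s => B * exp (c * (s - t0))) t0 t); auto.
    + apply RInt_correct, ex_RInt_continuous. auto.
    + apply (is_RInt_derive (fun s => B / c * exp (c * (s - t0)))).
      * intros s _. auto_derive; [exact I|]. unfold Rminus. field. lra.
      * intros s _. apply (ex_derive_continuous (V := R_NormedModule)).
        auto_derive. exact I.
  - assert (0 <= B / c * exp (c * (t0 - t0))); [|lra].
    apply Rmult_le_pos; [apply Rdiv_le_0_compat; lra|left; apply exp_pos].
Qed.

(** [Rmax] freezes the iterate at [x0] to the left of [t0], so that all iterates are continuous on
    the whole line and the estimates carry no side condition on [t]. *)
Definition picard_step {V : CompleteNormedModule R_AbsRing} (h : V -> R -> V)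
  (t0 : R) (x0 : V) (phi : R -> V) (t : R) : V :=
  plus x0 (RInt (fun s => h (phi s) s) t0 (Rmax t0 t)).

Lemma continuous_Rmax_l (a t : R) : continuous (Rmax a) t.
Proof.
  apply continuity_pt_filterlim.
  apply (continuity_pt_ext (fun s => (a + s + Rabs (a - s)) / 2)).
  - intros s. unfold Rmax, Rabs. destruct (Rle_dec a s), (Rcase_abs (a - s)); lra.
  - apply continuity_pt_filterlim.
    apply (continuous_scal_l (V := R_NormedModule) (fun s => a + s + Rabs (a - s)) (/ 2)).
    apply (continuous_plus (V := R_NormedModule)).
    + apply (continuous_plus (V := R_NormedModule)); [apply continuous_const|apply continuous_id].
    + apply (continuous_comp (fun s => a - s) Rabs).
      * apply (continuous_minus (V := R_NormedModule));
          [apply continuous_const|apply continuous_id].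
      * apply continuous_Rabs.
Qed.

Lemma is_derive_RInt_continuous {V : CompleteNormedModule R_AbsRing} (f : R -> V)
  (t0 t : R) :
  (forall s, continuous f s) -> is_derive (fun s => RInt f t0 s) t (f t).
Proof.
  intros Hf. apply (is_derive_RInt f (fun s => RInt f t0 s) t0 t); [|apply Hf].
  apply filter_forall. intros s. apply RInt_correct, ex_RInt_continuous. auto.
Qed.

Lemma is_derive_primitive {V : CompleteNormedModule R_AbsRing} (f : R -> V)
  (x0 : V) (t0 t : R) :
  (forall s, continuous f s) ->
  is_derive (fun s => plus x0 (RInt f t0 s)) t (f t).
Proof.
  intros Hf.
  replace (f t) with (plus zero (f t)) by apply plus_zero_l.
  apply (is_derive_plus (fun _ => x0)).
  - apply (is_derive_const (K := R_AbsRing) (V := V)).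
  - apply is_derive_RInt_continuous, Hf.
Qed.

Lemma picard_step_continuous {V : CompleteNormedModule R_AbsRing}
  (h : V -> R -> V) (t0 : R) (x0 : V) (phi : R -> V) (t : R) :
  (forall s, continuous (fun r => h (phi r) r) s) ->
  continuous (picard_step h t0 x0 phi) t.
Proof.
  intros Hc.
  apply (continuous_comp (Rmax t0)
           (fun r => plus x0 (RInt (fun s => h (phi s) s) t0 r))).
  - apply continuous_Rmax_l.
  - apply (ex_derive_continuous (V := V)). eexists.
    apply (is_derive_primitive (fun s => h (phi s) s)). exact Hc.
Qed.

Lemma picard_step_contract {V : CompleteNormedModule R_AbsRing}
  (h : V -> R -> V) (L B t0 : R) (x0 : V) (phi psi : R -> V) :
  0 < L -> 0 <= B ->
  (forall x y s, norm (minus (h x s) (h y s)) <= L * norm (minus x y)) ->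
  (forall s, continuous (fun r => h (phi r) r) s) ->
  (forall s, continuous (fun r => h (psi r) r) s) ->
  (forall s, norm (minus (phi s) (psi s)) <= B * exp (2 * L * (Rmax t0 s - t0))) ->
  forall t, norm (minus (picard_step h t0 x0 phi t) (picard_step h t0 x0 psi t))
    <= B / 2 * exp (2 * L * (Rmax t0 t - t0)).
Proof.
  intros HL HB Hlip Hphi Hpsi Hd t. unfold picard_step.
  replace (minus _ _) with
    (RInt (fun s => minus (h (phi s) s) (h (psi s) s)) t0 (Rmax t0 t)).
  - replace (B / 2) with (L * B / (2 * L)) by (field; lra).
    apply norm_RInt_exp_le.
    + lra.
    + apply Rmult_le_pos; lra.
    + apply Rmax_l.
    + intros s. apply (continuous_minus (V := V)); auto.
    + intros s Hs. eapply Rle_trans; [apply Hlip|].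
      rewrite Rmult_assoc. apply Rmult_le_compat_l; [lra|].
      specialize (Hd s). rewrite Rmax_right in Hd; [exact Hd|lra].
  - rewrite (RInt_minus (fun s => h (phi s) s) (fun s => h (psi s) s));
      [|apply ex_RInt_continuous; auto..].
    symmetry. apply (minus_plus_l (G := CompleteNormedModule.AbelianGroup _ V)).
Qed.

(* In the weighted norm [sup_t exp (-2L(t - t0)) |phi t|] the Picard operator
   contracts by 1/2, so the iterates converge on the whole half-line. *)
Lemma lipschitz_global_solution {V : CompleteNormedModule R_AbsRing}
  (h : V -> R -> V) (L M t0 : R) (x0 : V) :
  0 < L ->
  (forall x y s, norm (minus (h x s) (h y s)) <= L * norm (minus x y)) ->
  (forall x s, continuous (h x) s) ->
  (forall s, norm (h x0 s) <= M) ->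
  exists phi : R -> V, phi t0 = x0 /\
    forall t, t0 <= t -> is_derive phi t (h (phi t) t).
Proof.
  intros HL Hlip Hc HM.
  set (d := fun x y : V => norm (minus x y) : R).
  assert (Hsym : forall x y, d x y = d y x).
  { intros x y. apply (norm_minus_sym (V := CompleteNormedModule.NormedModule _ V)). }
  assert (Htri : forall x y z, d x z <= d x y + d y z).
  { intros x y z.
    apply (norm_minus_triangle (V := CompleteNormedModule.NormedModule _ V)). }
  set (w := fun t => exp (2 * L * (Rmax t0 t - t0))).
  assert (Hw : forall t, 0 < w t) by (intros; apply exp_pos).
  set (u := fun n => Nat.iter n (picard_step h t0 x0) (fun _ => x0)).
  assert (Hcomp : forall phi, (forall s, continuous phi s) ->
    forall s, continuous (fun r => h (phi r) r) s).
  { intros phi Hphi s. apply (continuous_lipschitz_comp (V := V) h L phi s); auto. }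
  assert (Hu : forall n t, continuous (u n) t).
  { induction n as [|n IH]; intros t.
    - apply continuous_const.
    - apply picard_step_continuous. auto. }
  assert (HM0 : 0 <= M) by exact (Rle_trans _ _ _ (norm_ge_0 (h x0 0)) (HM 0)).
  (* Weighted size of the first increment, where the field is evaluated at the constant [x0] and
     bounded by [M]. *)
  set (C := M / (2 * L)).
  assert (HC : 0 <= C) by (apply Rdiv_le_0_compat; lra).
  assert (Hp : forall n, 0 < (/ 2) ^ n) by (intros; apply pow_lt; lra).
  assert (Hstep : forall n t, d (u (S n) t) (u n t) <= C * (/ 2) ^ n * w t).
  { induction n as [|n IH]; intros t.
    - simpl. unfold picard_step, d.
      replace (minus _ _) with (RInt (fun s => h x0 s) t0 (Rmax t0 t)).
      + rewrite Rmult_1_r. apply norm_RInt_exp_le; auto; try lra.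
        * apply Rmax_l.
        * intros s Hs. eapply Rle_trans; [apply HM|].
          rewrite <- (Rmult_1_r M) at 1. apply Rmult_le_compat_l; [assumption|].
          rewrite <- exp_0. apply exp_le_compat. apply Rmult_le_pos; lra.
      + symmetry. apply (minus_plus_r (G := CompleteNormedModule.AbelianGroup _ V)).
    - replace (C * (/ 2) ^ S n) with (C * (/ 2) ^ n / 2) by (simpl; field).
      apply (picard_step_contract h L (C * (/ 2) ^ n) t0 x0 (u (S n)) (u n)); auto.
      apply Rmult_le_pos; [assumption|left; auto]. }
  assert (Htail : forall n m t,
    d (u (m + n)%nat t) (u n t) <= 2 * C * (/ 2) ^ n * w t).
  { intros n m t.
    (* The exact partial geometric sum is what makes the induction on [m] close. *)
    apply Rle_trans with (2 * C * ((/ 2) ^ n - (/ 2) ^ (m + n)) * w t).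
    - induction m as [|m IH].
      + simpl. rewrite Rminus_diag, Rmult_0_r, Rmult_0_l.
        right. apply (norm_minus_diag (V := CompleteNormedModule.NormedModule _ V)).
      + eapply Rle_trans; [apply (Htri _ (u (m + n)%nat t))|].
        eapply Rle_trans; [exact (Rplus_le_compat _ _ _ _ (Hstep (m + n)%nat t) IH)|].
        simpl. lra.
    - apply Rmult_le_compat_r; [left; auto|].
      apply Rmult_le_compat_l; [lra|]. pose proof (Hp (m + n)%nat). lra. }
  assert (Hgeo : forall K eps, 0 <= K -> 0 < eps -> exists n, K * (/ 2) ^ n < eps).
  { intros K eps HK Heps.
    assert (H0 : 0 < eps / (K + 1)) by (apply Rdiv_lt_0_compat; lra).
    destruct (pow_lt_1_zero (/ 2)) with (y := eps / (K + 1)) as [N HN]; auto.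
    { rewrite Rabs_pos_eq; lra. }
    exists N. specialize (HN N (le_n N)).
    rewrite Rabs_pos_eq in HN; [|left; auto].
    apply (Rmult_lt_compat_l (K + 1)) in HN; [|lra].
    replace ((K + 1) * (eps / (K + 1))) with eps in HN by (field; lra).
    pose proof (Hp N). nra. }
  set (phi := fun t => iota (fun x => filterlim (fun n => u n t) eventually (locally x))).
  assert (Hlim : forall t, filterlim (fun n => u n t) eventually (locally (phi t))).
  { intros t.
    assert (Hex : exists x, filterlim (fun n => u n t) eventually (locally x)).
    { apply (filterlim_locally_cauchy (U := CompleteNormedModule.CompleteSpace _ V)).
      intros eps.
      destruct (Hgeo (4 * C * w t) eps) as [N HN].
      { apply Rmult_le_pos; [lra|left; auto]. }
      { apply cond_pos. }
      exists (fun n => (N <= n)%nat). split.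
      { exists N. auto. }
      intros n m Hn Hm. apply (norm_compat1 (V := CompleteNormedModule.NormedModule _ V)).
      change (d (u m t) (u n t) < eps).
      eapply Rle_lt_trans; [apply (Htri _ (u N t))|].
      rewrite (Hsym (u N t)).
      pose proof (Htail N (n - N)%nat t) as H1. pose proof (Htail N (m - N)%nat t) as H2.
      rewrite Nat.sub_add in H1, H2 by assumption. nra. }
    destruct Hex as [x Hx]. unfold phi.
    rewrite (iota_filterlim_locally _ x Hx). exact Hx. }
  assert (Hphi : forall n t, d (phi t) (u n t) <= 2 * C * (/ 2) ^ n * w t).
  { intros n t. apply le_epsilon. intros eps Heps.
    destruct (proj1 (filterlim_locally_ball_norm _ _) (Hlim t) (mkposreal eps Heps))
      as [N HN].
    specialize (HN (N + n)%nat (Nat.le_add_r N n)). unfold ball_norm in HN. simpl in HN.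
    change (d (u (N + n)%nat t) (phi t) < eps) in HN.
    eapply Rle_trans; [apply (Htri _ (u (N + n)%nat t))|].
    rewrite (Hsym (phi t)). pose proof (Htail n N t). lra. }
  assert (Hphic : forall t, continuous phi t).
  { intros t. apply (filterlim_locally_ball_norm (U := CompleteNormedModule.NormedModule _ V)).
    intros eps.
    assert (He : 0 < eps / 3) by (destruct eps; simpl; lra).
    (* The weight at [t + 1] dominates all weights to its left, so convergence is uniform near [t]
       and continuity passes to the limit. *)
    destruct (Hgeo (2 * C * w (Rmax t0 t + 1)) (eps / 3)) as [n Hn]; [|lra|].
    { apply Rmult_le_pos; [lra|left; auto]. }
    assert (Hnb : forall s, s <= t + 1 -> d (phi s) (u n s) < eps / 3).
    { intros s Hs. eapply Rle_lt_trans; [apply Hphi|]. eapply Rle_lt_trans; [|exact Hn].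
      rewrite !(Rmult_assoc (2 * C)). apply Rmult_le_compat_l; [lra|].
      rewrite Rmult_comm. apply Rmult_le_compat_r; [left; auto|].
      apply exp_le_compat. apply Rmult_le_compat_l; [lra|].
      unfold Rmax. repeat destruct Rle_dec; lra. }
    generalize (filter_and _ _
      (proj1 (filterlim_locally_ball_norm _ _) (Hu n t) (mkposreal _ He))
      (locally_ball t (mkposreal 1 Rlt_0_1))).
    apply filter_imp. intros s [H1 H2]. unfold ball_norm in *. simpl in H1.
    change (d (u n s) (u n t) < eps / 3) in H1.
    change (d (phi s) (phi t) < eps).
    assert (Hs : s <= t + 1).
    { apply Rabs_lt_between' in H2. simpl in H2. lra. }
    eapply Rle_lt_trans; [apply (Htri _ (u n s))|].
    pose proof (Hnb s Hs) as G1.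
    pose proof (Htri (u n s) (u n t) (phi t)) as G2.
    assert (G3 : d (phi t) (u n t) < eps / 3) by (apply Hnb; lra). rewrite Hsym in G3.
    lra. }
  assert (Hfix : forall t, phi t = picard_step h t0 x0 phi t).
  { intros t. apply (ball_norm_eq (V := CompleteNormedModule.NormedModule _ V)). intros eps.
    change (d (picard_step h t0 x0 phi t) (phi t) < eps).
    destruct (Hgeo (2 * C * w t) eps) as [n Hn].
    { apply Rmult_le_pos; [lra|left; auto]. }
    { apply cond_pos. }
    rewrite Hsym.
    (* Both sides are close to [u (S n)]: [phi] by the tail bound, its Picard image by contraction
       from [u n]. *)
    eapply Rle_lt_trans; [apply (Htri _ (u (S n) t))|].
    pose proof (Hphi (S n) t) as H1.
    assert (H2 : d (u (S n) t) (picard_step h t0 x0 phi t)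
              <= 2 * C * (/ 2) ^ n / 2 * w t).
    { rewrite Hsym.
      apply (picard_step_contract h L (2 * C * (/ 2) ^ n) t0 x0 phi (u n)); auto.
      - apply Rmult_le_pos; [lra|left; auto].
      - apply Hphi. }
    change ((/ 2) ^ S n) with (/ 2 * (/ 2) ^ n) in H1. nra. }
  (* [phi] is constant to the left of [t0] and may have a corner there; the primitive without [Rmax]
     agrees with it from [t0] on and is differentiable on both sides. *)
  set (psi := fun t => plus x0 (RInt (fun s => h (phi s) s) t0 t)).
  assert (Heq : forall t, t0 <= t -> phi t = psi t).
  { intros t Ht. rewrite Hfix. unfold picard_step. rewrite Rmax_right; auto. }
  exists psi. split.
  - unfold psi. rewrite RInt_point. apply plus_zero_r.
  - intros t Ht. rewrite <- Heq by assumption.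
    apply (is_derive_primitive (fun s => h (phi s) s)). auto.
Qed.

(** * One-sided derivatives and quadratic forms with time-varying coefficients *)

(** Transfers an ordinary differential to one relative to [D]: the restricted filter is finer, and
    since [x] lies in [D] it is proper with unique limit [x]. *)
Lemma filterdiff_within {K : AbsRing} {U V : NormedModule K} (D : U -> Prop)
  (f g l : U -> V) (x : U) :
  D x -> (forall y, D y -> g y = f y) ->
  filterdiff g (locally x) l -> filterdiff f (within D (locally x)) l.
Proof.
  intros Dx Hgf Hg.
  assert (HP : ProperFilter (within D (locally x))).
  { split; [|apply within_filter, locally_filter].
    intros P HP. exists x. exact (locally_singleton _ _ HP Dx). }
  assert (Hlim : is_filter_lim (within D (locally x)) x).
  { intros P HP'. apply filter_le_within. exact HP'. }
  apply (filterdiff_ext_loc g).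
  - unfold within. apply filter_forall. exact Hgf.
  - intros y Hy. rewrite <- (is_filter_lim_unique _ _ Hlim Hy). auto.
  - apply filterdiff_locally with x; assumption.
Qed.

(* Continuing [f] affinely to the left of [a] makes it differentiable everywhere, so
   that one-sided derivatives need no separate calculus. *)
Lemma derive_within_extension {V : NormedModule R_AbsRing} (a : R) (f df : R -> V) :
  (forall t, a <= t -> is_derive_within (fun s => a <= s) f t (df t)) ->
  forall t : R, is_derive (fun s => plus (f (Rmax a s)) (scal (Rmin a s - a) (df a))) t
              (df (Rmax a t)).
Proof.
  intros Hf t.
  set (F := fun s => plus (f (Rmax a s)) (scal (Rmin a s - a) (df a))).
  assert (Fge : forall s, a <= s -> F s = f s).
  { intros s Hs. unfold F. rewrite Rmax_right, Rmin_left, Rminus_diag by assumption.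
    transitivity (plus (f s) zero); [|apply plus_zero_r].
    f_equal. exact (scal_zero_l (df a)). }
  assert (Fle : forall s, s <= a -> F s = plus (f a) (scal (s - a) (df a))).
  { intros s Hs. unfold F. rewrite Rmax_left, Rmin_right by assumption. reflexivity. }
  destruct (Rlt_le_dec t a) as [Hta|Hta].
  - rewrite Rmax_left by lra.
    apply (is_derive_ext_loc (fun s => plus (f a) (scal (s - a) (df a)))).
    + generalize (open_lt a t Hta). apply filter_imp. intros s Hs.
      symmetry. apply Fle. lra.
    + assert (Hs : is_derive (fun s => scal (s - a) (df a)) t (scal 1 (df a))).
      { apply (is_derive_scal_l (fun s => s - a)). auto_derive; [exact I|reflexivity]. }
      pose proof (is_derive_plus _ _ t _ _
        (is_derive_const (K := R_AbsRing) (V := V) (f a) t) Hs) as H.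
      rewrite plus_zero_l in H.
      replace (scal 1 (df a)) with (df a) in H by exact (eq_sym (scal_one (df a))).
      exact H.
  - rewrite Rmax_right by assumption.
    change (is_derive F t (df t)).
    split; [apply is_linear_scal_l|].
    intros x Hx. apply (is_filter_lim_locally_unique (V := AbsRing_NormedModule R_AbsRing)) in Hx.
    subst x. intros eps.
    destruct (Hf t Hta) as [_ H].
    specialize (H t (fun P HP => filter_le_within _ _ HP) eps).
    (* Points left of [a] occur near [t] only if [t = a]; there the continuation is affine with
       slope [df a], so its remainder is zero. *)
    assert (Hloc : locally t (fun y => a < t -> a < y)).
    { destruct (Req_dec a t) as [->|Hn].
      - apply filter_forall. intros y Hy. exfalso. exact (Rlt_irrefl _ Hy).
      - assert (H0 : a < t) by lra. generalize (open_gt a t H0). apply filter_imp. auto. }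
    generalize (filter_and _ _ Hloc H).
    apply filter_imp. intros y [Hy1 Hy2].
    destruct (Rle_lt_dec a y) as [Hay|Hay].
    + rewrite !Fge by assumption. apply Hy2. exact Hay.
    + assert (t = a) as -> by (destruct Hta; [specialize (Hy1 H0); lra|auto]).
      rewrite (Fge a), Fle by lra.
      rewrite (minus_plus_r (G := NormedModule.AbelianGroup _ V)).
      eapply Rle_trans; [right; apply (norm_minus_diag (V := V))|].
      apply Rmult_le_pos; [left; apply cond_pos|apply norm_ge_0].
Qed.

Lemma is_derive_fst {U V : NormedModule R_AbsRing} (f : R -> U * V) (t : R) (l : U * V) :
  is_derive f t l -> is_derive (fun s => fst (f s)) t (fst l).
Proof.
  intros Hf. eapply filterdiff_ext_lin.
  - apply (filterdiff_comp' f fst); [exact Hf|].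
    apply filterdiff_linear, (is_linear_fst (U := U) (V := V)).
  - reflexivity.
Qed.

Lemma is_derive_snd {U V : NormedModule R_AbsRing} (f : R -> U * V) (t : R) (l : U * V) :
  is_derive f t l -> is_derive (fun s => snd (f s)) t (snd l).
Proof.
  intros Hf. eapply filterdiff_ext_lin.
  - apply (filterdiff_comp' f snd); [exact Hf|].
    apply filterdiff_linear, (is_linear_snd (U := U) (V := V)).
  - reflexivity.
Qed.

Lemma continuous_pair {T U V : UniformSpace} (f : T -> U) (g : T -> V) (x : T) :
  continuous f x -> continuous g x -> continuous (fun y => (f y, g y)) x.
Proof.
  intros Hf Hg. apply filterlim_locally. intros eps.
  generalize (filter_and _ _ (proj1 (filterlim_locally _ _) Hf eps)
                (proj1 (filterlim_locally _ _) Hg eps)).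
  apply filter_imp. intros y H. exact H.
Qed.

Lemma continuous_extension {U : UniformSpace} (a : R) (f : R -> U) :
  continuous_on (fun s => a <= s) f -> forall t, continuous (fun s => f (Rmax a s)) t.
Proof.
  intros Hf t.
  apply (filterlim_comp _ _ _ (Rmax a) f _ (within (fun s => a <= s) (locally (Rmax a t)))).
  - intros P HP. unfold filtermap.
    generalize (continuous_Rmax_l a t _ HP). unfold filtermap.
    apply filter_imp. intros s Hs. apply Hs, Rmax_l.
  - apply Hf, Rmax_l.
Qed.

(** * Quadratic forms on the plane and their differentials *)

Lemma norm_pair_sqr (x : R * R) : norm x ^ 2 = fst x ^ 2 + snd x ^ 2.
Proof.
  change (norm x) with (sqrt (Rabs (fst x) ^ 2 + Rabs (snd x) ^ 2)).
  rewrite pow2_sqrt, !pow2_abs; [reflexivity|].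
  apply Rplus_le_le_0_compat; apply pow2_ge_0.
Qed.

Definition quad (a b c : R) (x : R * R) : R :=
  a * fst x ^ 2 + b * snd x ^ 2 + c * (fst x * snd x).

Definition quad_grad (a b c : R) (x : R * R) : R * R :=
  (2 * a * fst x + c * snd x, 2 * b * snd x + c * fst x).

Lemma filterdiff_coef (a da : R -> R) (q : (R * R) * R) :
  (forall t, is_derive a t (da t)) ->
  filterdiff (fun q : (R * R) * R => a (snd q)) (locally q)
    (fun v : (R * R) * R => snd v * da (snd q)).
Proof.
  intros Ha. destruct q as [x t].
  eapply filterdiff_ext_lin.
  - apply (filterdiff_comp' snd a (x, t)).
    + apply filterdiff_linear, (is_linear_snd (U := prod_NormedModule _ _ _)).
    + apply Ha.
  - reflexivity.
Qed.

Lemma filterdiff_fst_fst (q : (R * R) * R) :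
  filterdiff (fun q : (R * R) * R => fst (fst q)) (locally q) (fun v => fst (fst v)).
Proof.
  apply filterdiff_linear.
  apply (is_linear_comp (fun q : (R * R) * R => fst q) (fun x : R * R => fst x));
    apply is_linear_fst.
Qed.

Lemma filterdiff_snd_fst (q : (R * R) * R) :
  filterdiff (fun q : (R * R) * R => snd (fst q)) (locally q) (fun v => snd (fst v)).
Proof.
  apply filterdiff_linear.
  apply (is_linear_comp (fun q : (R * R) * R => fst q) (fun x : R * R => snd x));
    [apply is_linear_fst|apply is_linear_snd].
Qed.

Lemma filterdiff_Rmult {U : NormedModule R_AbsRing} (f g lf lg : U -> R) (x : U) :
  filterdiff f (locally x) lf -> filterdiff g (locally x) lg ->
  filterdiff (fun y => f y * g y) (locally x) (fun y => lf y * g x + f x * lg y).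
Proof.
  intros Hf Hg.
  apply (filterdiff_mult_fct (K := R_AbsRing) f g x lf lg); auto. apply Rmult_comm.
Qed.

Lemma filterdiff_Rplus {U : NormedModule R_AbsRing} (f g lf lg : U -> R) (x : U) :
  filterdiff f (locally x) lf -> filterdiff g (locally x) lg ->
  filterdiff (fun y => f y + g y) (locally x) (fun y => lf y + lg y).
Proof.
  intros Hf Hg. apply (filterdiff_plus_fct (K := R_AbsRing) f g lf lg); auto.
Qed.

(** Since [quad] is linear in its coefficients, its time derivative is again a [quad], with the
    differentiated coefficients. *)
Lemma quad_filterdiff (a b c da db dc : R -> R) (x : R * R) (t : R) :
  (forall t, is_derive a t (da t)) ->
  (forall t, is_derive b t (db t)) ->
  (forall t, is_derive c t (dc t)) ->
  filterdiff (fun q : (R * R) * R => quad (a (snd q)) (b (snd q)) (c (snd q)) (fst q))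
    (locally ((x, t) : (R * R) * R))
    (fun v : (R * R) * R => dot (quad_grad (a t) (b t) (c t) x) (fst v)
                            + quad (da t) (db t) (dc t) x * snd v).
Proof.
  intros Ha Hb Hc. set (q := (x, t) : (R * R) * R).
  pose proof (filterdiff_fst_fst q) as X1. pose proof (filterdiff_snd_fst q) as X2.
  pose proof (filterdiff_Rplus _ _ _ _ q
    (filterdiff_Rplus _ _ _ _ q
      (filterdiff_Rmult _ _ _ _ q (filterdiff_coef a da q Ha)
        (filterdiff_Rmult _ _ _ _ q X1 X1))
      (filterdiff_Rmult _ _ _ _ q (filterdiff_coef b db q Hb)
        (filterdiff_Rmult _ _ _ _ q X2 X2)))
    (filterdiff_Rmult _ _ _ _ q (filterdiff_coef c dc q Hc)
      (filterdiff_Rmult _ _ _ _ q X1 X2))) as H.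
  refine (filterdiff_ext_lin _ _ _ (filterdiff_ext _ _ _ _ H) _).
  - intros [y s]. unfold quad. simpl. ring.
  - intros [v s]. unfold dot, quad_grad, quad. simpl. ring.
Qed.

Lemma continuous_Rplus {T : UniformSpace} (f g : T -> R) (q : T) :
  continuous f q -> continuous g q -> continuous (fun q => f q + g q) q.
Proof. apply (continuous_plus (V := R_NormedModule)). Qed.

Lemma continuous_Rmult {T : UniformSpace} (f g : T -> R) (q : T) :
  continuous f q -> continuous g q -> continuous (fun q => f q * g q) q.
Proof. apply (continuous_mult (K := R_AbsRing)). Qed.

Lemma quad_continuous {T : UniformSpace} (a b c : T -> R) (x : T -> R * R) (q : T) :
  continuous a q -> continuous b q -> continuous c q -> continuous x q ->
  continuous (fun q => quad (a q) (b q) (c q) (x q)) q /\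
  continuous (fun q => quad_grad (a q) (b q) (c q) (x q)) q.
Proof.
  intros Ha Hb Hc Hx.
  assert (H1 : continuous (fun q => fst (x q)) q).
  { apply (continuous_comp x fst); [exact Hx|apply continuous_fst]. }
  assert (H2 : continuous (fun q => snd (x q)) q).
  { apply (continuous_comp x snd); [exact Hx|apply continuous_snd]. }
  assert (Hsq : forall f : T -> R, continuous f q -> continuous (fun q => f q ^ 2) q).
  { intros f Hf. apply (continuous_Rmult f (fun q => f q * 1)); [exact Hf|].
    apply continuous_Rmult; [exact Hf|apply continuous_const]. }
  assert (Hdbl : forall f : T -> R, continuous f q -> continuous (fun q => 2 * f q) q).
  { intros f Hf. apply continuous_Rmult; [apply continuous_const|exact Hf]. }
  split.
  - unfold quad.
    apply (continuous_Rplus (fun q => a q * fst (x q) ^ 2 + b q * snd (x q) ^ 2)).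
    + apply (continuous_Rplus (fun q => a q * fst (x q) ^ 2)).
      * apply (continuous_Rmult a); auto.
      * apply (continuous_Rmult b); auto.
    + apply (continuous_Rmult c); [exact Hc|].
      apply (continuous_Rmult (fun q => fst (x q))); assumption.
  - unfold quad_grad. apply continuous_pair.
    + apply (continuous_Rplus (fun q => 2 * a q * fst (x q))).
      * apply (continuous_Rmult (fun q => 2 * a q)); auto.
      * apply (continuous_Rmult c); assumption.
    + apply (continuous_Rplus (fun q => 2 * b q * snd (x q))).
      * apply (continuous_Rmult (fun q => 2 * b q)); auto.
      * apply (continuous_Rmult c); assumption.
Qed.

(** The coefficients live on the whole line, while [W] need only agree with the form at nonnegative
    times; [filterdiff_within] then restricts the differential. *)
Lemma quad_C1_state_time (a b c da db dc : R -> R) (W : R * R -> R -> R) :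
  (forall t, is_derive a t (da t)) -> (forall t, continuous da t) ->
  (forall t, is_derive b t (db t)) -> (forall t, continuous db t) ->
  (forall t, is_derive c t (dc t)) -> (forall t, continuous dc t) ->
  (forall x t, 0 <= t -> W x t = quad (a t) (b t) (c t) x) ->
  C1_state_time W (fun x t => quad_grad (a t) (b t) (c t) x)
    (fun x t => quad (da t) (db t) (dc t) x).
Proof.
  intros Ha Hda Hb Hdb Hc Hdc HW.
  assert (Hsnd : forall (f : R -> R) (q : (R * R) * R), (forall t, continuous f t) ->
    continuous (fun q : (R * R) * R => f (snd q)) q).
  { intros f q Hf. apply (continuous_comp snd f); [apply continuous_snd|apply Hf]. }
  assert (Hcont : forall f df : R -> R, (forall t, is_derive f t (df t)) ->
    forall t, continuous f t).
  { intros f df Hf t. apply (ex_derive_continuous (V := R_NormedModule)).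
    eexists. apply Hf. }
  split; [|split].
  - intros x t Ht.
    apply (filterdiff_within _ _
      (fun q : (R * R) * R => quad (a (snd q)) (b (snd q)) (c (snd q)) (fst q))).
    + exact Ht.
    + intros q Hq. symmetry. apply HW. exact Hq.
    + apply quad_filterdiff; assumption.
  - apply continuous_on_forall. intros q _.
    apply (quad_continuous (fun q : (R * R) * R => a (snd q)) (fun q => b (snd q))
      (fun q => c (snd q)) fst q); try (apply Hsnd; eapply Hcont; eassumption).
    apply continuous_fst.
  - apply continuous_on_forall. intros q _.
    apply (quad_continuous (fun q : (R * R) * R => da (snd q)) (fun q => db (snd q))
      (fun q => dc (snd q)) fst q); try (apply Hsnd; assumption).
    apply continuous_fst.
Qed.

(** * Exponential and quadratic comparison functions *)

Lemma exponential_class_KL (C lam : R) :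
  0 < C -> 0 < lam -> class_KL (fun s t => C * s * exp (- lam * t)).
Proof.
  intros HC Hlam.
  assert (He : forall t, 0 < exp (- lam * t)) by (intros; apply exp_pos).
  split; [|split; [|split; [|split]]].
  - apply continuous_on_forall. intros q _.
    apply (continuous_mult (K := R_AbsRing)).
    + apply (continuous_mult (K := R_AbsRing)); [apply continuous_const|apply continuous_fst].
    + apply (continuous_comp snd (fun t => exp (- lam * t))).
      * apply continuous_snd.
      * apply (ex_derive_continuous (V := R_NormedModule)). auto_derive. exact I.
  - intros s t Hs Ht. apply Rmult_le_pos; [apply Rmult_le_pos; lra|left; auto].
  - intros t Ht. specialize (He t). assert (HCe : 0 < C * exp (- lam * t)) by nra.
    repeat split.
    + intros s Hs. nra.
    + apply continuous_on_forall. intros s _.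
      apply (ex_derive_continuous (V := R_NormedModule)). auto_derive. exact I.
    + intros s r Hs Hr. nra.
    + intros M. exists ((Rabs M + 1) / (C * exp (- lam * t))).
      pose proof (Rabs_pos M). pose proof (Rle_abs M). split.
      * apply Rdiv_le_0_compat; lra.
      * replace (C * _ * _) with (Rabs M + 1) by (field; lra). lra.
    + ring.
  - intros s t r Hs Ht Hr. apply Rmult_le_compat_l; [nra|].
    apply exp_le_compat. nra.
  - intros s Hs.
    replace (Finite 0) with (Rbar_mult (C * s) 0) by (simpl; f_equal; ring).
    apply is_lim_scal_l.
    apply (is_lim_comp exp (fun t => - lam * t) p_infty 0 m_infty).
    + apply is_lim_exp_m.
    + replace m_infty with (Rbar_mult (- lam) p_infty).
      * apply is_lim_scal_l, is_lim_id.
      * apply is_Rbar_mult_unique. apply is_Rbar_mult_sym, is_Rbar_mult_p_infty_neg.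
        simpl. lra.
    + exists 0. intros. discriminate.
Qed.

Lemma square_class_Kinf (m : R) : 0 < m -> class_Kinf (fun s => m * s ^ 2).
Proof.
  intros Hm. repeat split.
  - intros s Hs. nra.
  - apply continuous_on_forall. intros s _.
    apply (ex_derive_continuous (V := R_NormedModule)). auto_derive. exact I.
  - intros s r Hs Hr. assert (s ^ 2 < r ^ 2) by nra. apply Rmult_lt_compat_l; assumption.
  (* The square of [y + 1] is at least [2 * y + 1] for [y >= 0], which spares a square root in the
     witness. *)
  - intros M. exists (Rabs M / m + 1).
    assert (HM : 0 <= Rabs M / m) by (apply Rdiv_le_0_compat; [apply Rabs_pos|assumption]).
    assert (HMm : Rabs M = m * (Rabs M / m)) by (field; lra).
    pose proof (Rle_abs M). set (y := Rabs M / m) in *. split; [lra|].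
    assert (0 <= m * y) by nra. assert (0 <= m * y ^ 2) by nra. nra.
  - ring.
Qed.

(** * Stability from a quadratic Lyapunov function *)

(** Along a trajectory the form times [exp (lam * (t - to))] has nonpositive derivative, so the mean
    value theorem on [[to, t]] bounds it by its initial value. *)
Lemma quad_decay (h : R * R -> R -> R * R) (a b c da db dc : R -> R) (lam to : R)
  (xo : R * R) (phi : R -> R * R) :
  (forall t, is_derive a t (da t)) ->
  (forall t, is_derive b t (db t)) ->
  (forall t, is_derive c t (dc t)) ->
  (forall x t, 0 <= t ->
     quad (da t) (db t) (dc t) x + dot (quad_grad (a t) (b t) (c t) x) (h x t)
     <= - lam * quad (a t) (b t) (c t) x) ->
  0 <= to -> is_trajectory h to xo phi ->
  forall t, to <= t ->
    quad (a t) (b t) (c t) (phi t)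
    <= quad (a to) (b to) (c to) xo * exp (- lam * (t - to)).
Proof.
  intros Ha Hb Hc Hdec Hto [Hxo Hphi] t Ht.
  (* Affine continuation of the trajectory to times before [to], differentiable everywhere. *)
  set (F := fun s => plus (phi (Rmax to s)) (scal (Rmin to s - to) (h (phi to) to))).
  assert (HF : forall s, is_derive F s (h (phi (Rmax to s)) (Rmax to s))).
  { apply (derive_within_extension to phi (fun s => h (phi s) s)). exact Hphi. }
  assert (HFphi : forall s, to <= s -> F s = phi s).
  { intros s Hs. unfold F. rewrite Rmax_right, Rmin_left, Rminus_diag by assumption.
    transitivity (plus (phi s) zero); [|apply plus_zero_r].
    f_equal. exact (scal_zero_l (h (phi to) to)). }
  set (g := fun s => quad (a s) (b s) (c s) (F s) * exp (lam * (s - to))).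
  set (dF := fun s => h (phi (Rmax to s)) (Rmax to s)).
  set (f1 := fun s => fst (F s)). set (f2 := fun s => snd (F s)).
  assert (H1 : forall s, is_derive f1 s (fst (dF s))) by (intros; apply is_derive_fst, HF).
  assert (H2 : forall s, is_derive f2 s (snd (dF s))) by (intros; apply is_derive_snd, HF).
  set (dg := fun s => (quad (da s) (db s) (dc s) (F s)
     + dot (quad_grad (a s) (b s) (c s) (F s)) (dF s)
     + lam * quad (a s) (b s) (c s) (F s)) * exp (lam * (s - to))).
  assert (Hg : forall s, is_derive g s (dg s)).
  { intros s. change (is_derive (fun s : R =>
      (a s * f1 s ^ 2 + b s * f2 s ^ 2 + c s * (f1 s * f2 s)) * exp (lam * (s - to)))
      s (dg s)).
    auto_derive.
    - repeat split; eexists; eauto.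
    - change (Derive (fun x => a x) s) with (Derive a s).
      change (Derive (fun x => b x) s) with (Derive b s).
      change (Derive (fun x => c x) s) with (Derive c s).
      change (Derive (fun x => f1 x) s) with (Derive f1 s).
      change (Derive (fun x => f2 x) s) with (Derive f2 s).
      rewrite (is_derive_unique _ _ _ (Ha s)), (is_derive_unique _ _ _ (Hb s)),
        (is_derive_unique _ _ _ (Hc s)), (is_derive_unique f1 _ _ (H1 s)),
        (is_derive_unique f2 _ _ (H2 s)).
      unfold dg, dot, quad, quad_grad, f1, f2, Rminus.
      generalize (F s) (dF s). intros [y1 y2] [v1 v2]. simpl. ring. }
  destruct (MVT_gen g to t dg) as [s [Hs Hgs]].
  { intros s _. apply Hg. }
  { intros s _. apply continuity_pt_filterlim.
    apply (ex_derive_continuous (V := R_NormedModule)). eexists. apply Hg. }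
  rewrite Rmin_left, Rmax_right in Hs by assumption.
  assert (Hdg : dg s <= 0).
  { unfold dg. pose proof (exp_pos (lam * (s - to))) as He.
    assert (Hs0 : 0 <= s) by lra. specialize (Hdec (phi s) s Hs0).
    rewrite HFphi by lra. unfold dF. rewrite Rmax_right by lra. nra. }
  assert (Hle : g t <= g to) by nra.
  unfold g in Hle. rewrite !HFphi, Hxo in Hle by lra.
  rewrite Rminus_diag, Rmult_0_r, exp_0, Rmult_1_r in Hle.
  apply (Rmult_le_compat_r (exp (- lam * (t - to)))) in Hle; [|left; apply exp_pos].
  rewrite Rmult_assoc, <- exp_plus in Hle.
  replace (lam * (t - to) + - lam * (t - to)) with 0 in Hle by ring.
  rewrite exp_0, Rmult_1_r in Hle. exact Hle.
Qed.

(** The two-sided bounds turn decay of the form into [|phi t|^2 <= (K / m) |xo|^2 exp (- lam (t -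
    to))]; taking square roots halves the rate and yields the comparison function. *)
Lemma quad_UGAS (h : R * R -> R -> R * R) (a b c da db dc : R -> R) (m K lam : R) :
  0 < m -> 0 < K -> 0 < lam ->
  (forall t, is_derive a t (da t)) ->
  (forall t, is_derive b t (db t)) ->
  (forall t, is_derive c t (dc t)) ->
  (forall x t, 0 <= t ->
     m * norm x ^ 2 <= quad (a t) (b t) (c t) x <= K * norm x ^ 2) ->
  (forall x t, 0 <= t ->
     quad (da t) (db t) (dc t) x + dot (quad_grad (a t) (b t) (c t) x) (h x t)
     <= - lam * quad (a t) (b t) (c t) x) ->
  (forall xo to, 0 <= to -> exists phi, is_trajectory h to xo phi) ->
  UGAS h.
Proof.
  intros Hm HK Hlam Ha Hb Hc Hbd Hdec Hex.
  assert (HKm : 0 < K / m) by (apply Rdiv_lt_0_compat; lra).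
  exists (fun s t => sqrt (K / m) * s * exp (- (lam / 2) * t)). split.
  - apply exponential_class_KL; [apply sqrt_lt_R0; assumption|lra].
  - intros xo to Hto. split; [apply Hex; assumption|].
    intros phi Hphi t Ht.
    pose proof (quad_decay h a b c da db dc lam to xo phi Ha Hb Hc Hdec Hto Hphi t Ht) as H.
    destruct (Hbd (phi t) t) as [H1 _]; [lra|].
    destruct (Hbd xo to Hto) as [_ H2].
    apply Rsqr_incr_0_var.
    + unfold Rsqr.
      replace (sqrt (K / m) * norm xo * exp (- (lam / 2) * (t - to)) *
        (sqrt (K / m) * norm xo * exp (- (lam / 2) * (t - to))))
        with ((sqrt (K / m) * sqrt (K / m)) * norm xo ^ 2 *
              (exp (- (lam / 2) * (t - to)) * exp (- (lam / 2) * (t - to)))) by ring.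
      rewrite sqrt_sqrt, <- exp_plus by lra.
      replace (- (lam / 2) * (t - to) + - (lam / 2) * (t - to))
        with (- lam * (t - to)) by field.
      apply (Rmult_le_reg_l m); [assumption|].
      replace (m * (K / m * norm xo ^ 2 * exp (- lam * (t - to))))
        with (K * norm xo ^ 2 * exp (- lam * (t - to))) by (field; lra).
      apply Rle_trans with (quad (a t) (b t) (c t) (phi t)); [simpl in H1 |- *; lra|].
      eapply Rle_trans; [exact H|]. apply Rmult_le_compat_r; [left; apply exp_pos|exact H2].
    + apply Rmult_le_pos; [apply Rmult_le_pos; [apply sqrt_pos|apply norm_ge_0]|].
      left. apply exp_pos.
Qed.

(** The lower bound on the form converts the decay [- lam W] into [- lam m |x|^2], which supplies
    the positive definite [alpha3]. *)
Lemma quad_is_Lyapunov (h : R * R -> R -> R * R) (a b c da db dc : R -> R)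
  (W : R * R -> R -> R) (m K lam : R) :
  0 < m -> 0 < K -> 0 < lam ->
  (forall t, is_derive a t (da t)) -> (forall t, continuous da t) ->
  (forall t, is_derive b t (db t)) -> (forall t, continuous db t) ->
  (forall t, is_derive c t (dc t)) -> (forall t, continuous dc t) ->
  (forall x t, 0 <= t -> W x t = quad (a t) (b t) (c t) x) ->
  (forall x t, 0 <= t ->
     m * norm x ^ 2 <= quad (a t) (b t) (c t) x <= K * norm x ^ 2) ->
  (forall x t, 0 <= t ->
     quad (da t) (db t) (dc t) x + dot (quad_grad (a t) (b t) (c t) x) (h x t)
     <= - lam * quad (a t) (b t) (c t) x) ->
  is_Lyapunov h W.
Proof.
  intros Hm HK Hlam Ha Hda Hb Hdb Hc Hdc HW Hbd Hdec.
  assert (Hlm : 0 < lam * m) by (apply Rmult_lt_0_compat; assumption).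
  split.
  - intros x t Ht. rewrite HW by assumption.
    apply Rle_trans with (2 := proj1 (Hbd x t Ht)).
    apply Rmult_le_pos; [lra|apply pow2_ge_0].
  - exists (fun x t => quad_grad (a t) (b t) (c t) x),
      (fun x t => quad (da t) (db t) (dc t) x),
      (fun s => m * s ^ 2), (fun s => K * s ^ 2), (fun s => lam * m * s ^ 2).
    split; [apply quad_C1_state_time; assumption|].
    split; [apply square_class_Kinf; assumption|].
    split; [apply square_class_Kinf; assumption|].
    split.
    + destruct (square_class_Kinf _ Hlm) as [Hpos [Hcont _]].
      split; [exact Hpos|split; [exact Hcont|]].
      intros s Hs. split; intros H; [|subst; ring].
      apply Rmult_integral in H. destruct H as [H|H]; [lra|].
      apply Rsqr_0_uniq. unfold Rsqr. lra.
    + intros x t Ht. rewrite HW by assumption. split; [apply Hbd; assumption|].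
      eapply Rle_trans; [apply Hdec; assumption|].
      pose proof (proj1 (Hbd x t Ht)). nra.
Qed.

(** * Bounds for [tanh] and sliding integrals *)

Lemma is_derive_lipschitz (f df : R -> R) (M : R) :
  (forall x, is_derive f x (df x)) -> (forall x, Rabs (df x) <= M) ->
  forall x y, Rabs (f x - f y) <= M * Rabs (x - y).
Proof.
  intros Hf HM x y.
  destruct (MVT_cor4 f df y (Rabs (x - y)) (fun c _ => Hf c) x (Rle_refl _))
    as [c [Hc _]].
  rewrite Hc, Rabs_mult. apply Rmult_le_compat_r; [apply Rabs_pos|apply HM].
Qed.

Lemma is_derive_tanh (x : R) : is_derive tanh x (1 - tanh x ^ 2).
Proof.
  pose proof (exp_pos x). pose proof (exp_pos (- x)).
  unfold tanh, sinh, cosh. auto_derive; [lra|]. field. lra.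
Qed.

(** This is [1 / cosh^2]; its numerator is kept as [exp x * exp (- x)] so that the identity is
    purely rational in the two exponentials. *)
Lemma tanh_derive_bounds (x : R) : 0 <= 1 - tanh x ^ 2 <= 1.
Proof.
  pose proof (exp_pos x). pose proof (exp_pos (- x)).
  assert (Hc : 0 < cosh x) by (unfold cosh; lra).
  split; [|pose proof (pow2_ge_0 (tanh x)); lra].
  replace (1 - tanh x ^ 2) with (exp x * exp (- x) / (cosh x * cosh x)).
  - apply Rdiv_le_0_compat; nra.
  - unfold tanh, sinh, cosh in *. field. lra.
Qed.

Lemma tanh_abs_le_1 (x : R) : Rabs (tanh x) <= 1.
Proof. apply Rabs_le. pose proof (tanh_derive_bounds x). nra. Qed.

Lemma tanh_lipschitz (x y : R) : Rabs (tanh x - tanh y) <= Rabs (x - y).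
Proof.
  rewrite <- (Rmult_1_l (Rabs (x - y))).
  apply is_derive_lipschitz with (fun x => 1 - tanh x ^ 2).
  - apply is_derive_tanh.
  - intros z. pose proof (tanh_derive_bounds z). apply Rabs_le. lra.
Qed.

Lemma tanh_0 : tanh 0 = 0.
Proof. unfold tanh. rewrite sinh_0. unfold Rdiv. ring. Qed.

(** By the mean value theorem from 0, [tanh x] is [x] times a slope in [[0, 1]]. The sign makes the
    friction dissipative, the size makes it at most linear. *)
Lemma tanh_sector (x : R) : 0 <= x * tanh x /\ Rabs (tanh x) <= Rabs x.
Proof.
  split.
  - destruct (MVT_cor4 tanh (fun x => 1 - tanh x ^ 2) 0 (Rabs (x - 0))
      (fun c _ => is_derive_tanh c) x (Rle_refl _)) as [c [Hc _]].
    rewrite tanh_0, !Rminus_0_r in Hc. rewrite Hc.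
    pose proof (tanh_derive_bounds c). nra.
  - pose proof (tanh_lipschitz x 0) as H. rewrite tanh_0, !Rminus_0_r in H. exact H.
Qed.

(** * Sliding and double integrals *)

Lemma sliding_integral_eq (sigma : R -> R) (T r : R) :
  (forall t, continuous sigma t) ->
  RInt sigma (r - T) r = RInt sigma 0 r - RInt sigma 0 (r - T).
Proof.
  intros Hs.
  assert (Hex : forall u v, ex_RInt sigma u v).
  { intros. apply (ex_RInt_continuous (V := R_CompleteNormedModule)). auto. }
  pose proof (RInt_Chasles sigma 0 (r - T) r (Hex _ _) (Hex _ _)) as H.
  change (RInt sigma 0 (r - T) + RInt sigma (r - T) r = RInt sigma 0 r) in H. lra.
Qed.

Lemma is_derive_sliding_integral (sigma : R -> R) (T r : R) :
  (forall t, continuous sigma t) ->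
  is_derive (fun r => RInt sigma (r - T) r) r (sigma r - sigma (r - T)).
Proof.
  intros Hs.
  apply (is_derive_ext (fun r => RInt sigma 0 r - RInt sigma 0 (r - T))).
  { intros t. symmetry. apply sliding_integral_eq, Hs. }
  pose proof (fun s => is_derive_RInt_continuous sigma 0 s Hs) as HS.
  set (S := fun s => RInt sigma 0 s) in *.
  change (is_derive (fun r => S r - S (r - T)) r (sigma r - sigma (r - T))).
  auto_derive.
  - repeat split; eexists; apply HS.
  - change (Derive (fun x => S x)) with (Derive S).
    rewrite !(is_derive_unique _ _ _ (HS _)). unfold Rminus. ring.
Qed.

(** With [S] a primitive of [sigma], the inner integral is [S r - S s], so the double integral
    equals [T * S r] minus a sliding integral of [S]; no differentiation under the integral sign is
    needed. *)
Lemma is_derive_double_integral (sigma : R -> R) (T r : R) :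
  (forall t, continuous sigma t) ->
  is_derive (fun r => RInt (fun s => RInt sigma s r) (r - T) r) r
    (T * sigma r - RInt sigma (r - T) r).
Proof.
  intros Hs.
  assert (Hex : forall u v, ex_RInt sigma u v).
  { intros. apply (ex_RInt_continuous (V := R_CompleteNormedModule)). auto. }
  pose proof (fun s => is_derive_RInt_continuous sigma 0 s Hs) as HS.
  set (S := fun s => RInt sigma 0 s) in *.
  assert (HSc : forall t, continuous S t).
  { intros t. apply (ex_derive_continuous (V := R_NormedModule)). eexists. apply HS. }
  assert (HexS : forall u v, ex_RInt S u v).
  { intros. apply (ex_RInt_continuous (V := R_CompleteNormedModule)). auto. }
  apply (is_derive_ext (fun r => T * S r - RInt S (r - T) r)).
  { intros t. symmetry.
    rewrite (RInt_ext _ (fun s => minus (S t) (S s))).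
    - rewrite (RInt_minus (fun _ => S t) S); [|apply ex_RInt_const|apply HexS].
      rewrite RInt_const. change ((t - (t - T)) * S t - RInt S (t - T) t
        = T * S t - RInt S (t - T) t). ring.
    - intros s _. change (RInt sigma s t = RInt sigma 0 t - RInt sigma 0 s).
      pose proof (RInt_Chasles sigma 0 s t (Hex _ _) (Hex _ _)) as H.
      change (RInt sigma 0 s + RInt sigma s t = RInt sigma 0 t) in H. lra. }
  pose proof (is_derive_sliding_integral S T r HSc) as HI.
  set (I0 := fun r => RInt S (r - T) r) in *.
  change (is_derive (fun r => T * S r - I0 r) r (T * sigma r - RInt sigma (r - T) r)).
  auto_derive.
  - repeat split; eexists; [apply HS|apply HI].
  - change (Derive (fun x => S x)) with (Derive S).
    change (Derive (fun x => I0 x)) with (Derive I0).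
    rewrite (is_derive_unique _ _ _ (HS _)), (is_derive_unique I0 _ _ HI).
    rewrite sliding_integral_eq by assumption. unfold S. ring.
Qed.

(** The inner integral lies in [[0, T]]. The crude [T * T] is enough, as only a bound uniform in [r]
    is wanted. *)
Lemma double_integral_bounds (sigma : R -> R) (T r : R) :
  0 <= T -> (forall t, continuous sigma t) -> (forall t, 0 < sigma t <= 1) ->
  0 <= RInt (fun s => RInt sigma s r) (r - T) r <= T * T.
Proof.
  intros HT Hc Hs.
  assert (Hex : forall u v, ex_RInt sigma u v).
  { intros. apply (ex_RInt_continuous (V := R_CompleteNormedModule)). auto. }
  assert (Hin : forall s, r - T <= s <= r -> 0 <= RInt sigma s r <= T).
  { intros s Hsr. split.
    - apply RInt_ge_0; [lra|apply Hex|]. intros x _. left. apply Hs.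
    - apply Rle_trans with (RInt (fun _ => 1) s r).
      + apply RInt_le; [lra|apply Hex|apply ex_RInt_const|]. intros x _. apply Hs.
      + rewrite RInt_const. change ((r - s) * 1 <= T). lra. }
  assert (Hex2 : ex_RInt (fun s => RInt sigma s r) (r - T) r).
  { apply (ex_RInt_continuous (V := R_CompleteNormedModule)). intros s _.
    apply (ex_derive_continuous (V := R_NormedModule)).
    apply (ex_derive_ext (fun s => opp (RInt sigma r s))).
    - intros t. apply opp_RInt_swap, Hex.
    - eexists. apply (is_derive_opp (V := R_NormedModule)).
      exact (is_derive_RInt_continuous sigma r s Hc). }
  split.
  - apply RInt_ge_0; [lra|exact Hex2|]. intros s Hsr. apply Hin. lra.
  - apply Rle_trans with (RInt (fun _ => T) (r - T) r).
    + apply RInt_le; [lra|exact Hex2|apply ex_RInt_const|]. intros s Hsr. apply Hin. lra.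
    + rewrite RInt_const. change ((r - (r - T)) * T <= T * T). lra.
Qed.

(** * The friction system *)

(** The first two bounds make the form coercive. In the third, twice the summand [ko / 2] of [A]
    gives [ko], and twice the last summand covers the loss in Young's inequality. *)
Lemma A_const_bounds (ko beta2 : R) :
  0 < ko -> 0 < beta2 ->
  1 <= A_const ko beta2 /\ 1 <= A_const ko beta2 * ko /\
  ko <= 2 * A_const ko beta2 - 1 - (1 + 2 * beta2) ^ 2 / (2 * ko).
Proof.
  intros Hko Hb. unfold A_const.
  set (B := (1 + 2 * beta2) ^ 2). assert (HB : 1 <= B) by (unfold B; nra).
  assert (HBk : 0 < B / ko) by (apply Rdiv_lt_0_compat; lra).
  split; [lra|split].
  - replace ((1 + ko / 2 + B / ko) * ko) with (ko + ko ^ 2 / 2 + B) by (field; lra). nra.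
  - replace (B / (2 * ko)) with (/ 2 * (B / ko)) by (field; lra). lra.
Qed.

(** The cross term is at most half of [|x|^2], while both diagonal coefficients are at least 1.
    Above, [A], [A * kbar] and the leftover [1 / 2] are each at most [A ^ 2 * kbar]. *)
Lemma quadratic_bounds (A ko kbar k s x1 x2 : R) :
  0 < ko -> ko <= k <= kbar -> 1 <= A -> 1 <= A * ko -> 0 < s <= 1 ->
  / 2 * (x1 ^ 2 + x2 ^ 2) <= A * k * x1 ^ 2 + A * x2 ^ 2 + s * (x1 * x2)
    <= 2 * A ^ 2 * kbar * (x1 ^ 2 + x2 ^ 2).
Proof.
  intros Hko Hk HA HAk Hs.
  assert (Hcross : - ((x1 ^ 2 + x2 ^ 2) / 2) <= s * (x1 * x2) <= (x1 ^ 2 + x2 ^ 2) / 2).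
  { pose proof (pow2_ge_0 (x1 - x2)). pose proof (pow2_ge_0 (x1 + x2)). split; nra. }
  pose proof (pow2_ge_0 x1) as H1. pose proof (pow2_ge_0 x2) as H2.
  assert (HAk' : A * ko <= A * k) by nra.
  assert (HAK : A * k <= A * kbar) by nra.
  assert (HK : 1 <= A * kbar) by lra.
  assert (HAA : A <= A ^ 2 * kbar) by nra.
  assert (HAAk : A * kbar <= A ^ 2 * kbar) by nra.
  split; nra.
Qed.

(** Here [u] stands for the [tanh] friction and [B] for [1 + 2 * beta2]. The terms in
    [A * k * x1 * x2] cancel; apart from those with [dk], [ds] and [A * x2 * u], everything left has
    the factor [s]. *)
Lemma dissipation (A B b ko kbar k dk s ds del u x1 x2 : R) :
  0 < ko -> ko <= k <= kbar -> dk <= 0 -> 1 <= A -> 1 <= A * ko ->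
  0 < s <= 1 -> Rabs ds <= del ->
  ko <= 2 * A - 1 - B ^ 2 / (2 * ko) -> 1 <= B ->
  b * (2 * A ^ 2 * kbar) = ko / 2 -> 0 <= b ->
  0 <= x2 * u -> Rabs u <= (B - 1) * Rabs x2 ->
  A * dk * x1 ^ 2 + ds * (x1 * x2)
    + ((2 * (A * k) * x1 + s * x2) * x2
       + (2 * A * x2 + s * x1) * (- s * x2 - k * x1 - u))
  <= (del - b * s) * (A * k * x1 ^ 2 + A * x2 ^ 2 + s * (x1 * x2)).
Proof.
  intros Hko Hk Hdk HA HAk Hs Hds HAB HB Hb Hb0 Hu1 Hu2.
  destruct (quadratic_bounds A ko kbar k s x1 x2) as [Hlo Hup]; try assumption.
  set (V := A * k * x1 ^ 2 + A * x2 ^ 2 + s * (x1 * x2)) in *.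
  pose proof (Rabs_pos x1) as P1. pose proof (Rabs_pos x2) as P2.
  pose proof (pow2_abs x1) as Q1. pose proof (pow2_abs x2) as Q2.
  assert (H12 : Rabs (x1 * x2) = Rabs x1 * Rabs x2) by apply Rabs_mult.
  assert (Hdel : ds * (x1 * x2) <= del * V).
  { eapply Rle_trans; [apply Rle_abs|]. rewrite Rabs_mult, H12.
    pose proof (Rabs_pos ds). pose proof (pow2_ge_0 (Rabs x1 - Rabs x2)).
    assert (Rabs x1 * Rabs x2 <= V) by nra.
    apply Rle_trans with (del * (Rabs x1 * Rabs x2)).
    - apply Rmult_le_compat_r; [nra|assumption].
    - apply Rmult_le_compat_l; lra. }
  assert (HV : b * V <= ko / 2 * (x1 ^ 2 + x2 ^ 2)).
  { rewrite <- Hb, Rmult_assoc. apply Rmult_le_compat_l; assumption. }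
  assert (Hxu : - (x1 * u) <= (B - 1) * (Rabs x1 * Rabs x2)).
  { eapply Rle_trans; [apply Rle_abs|]. rewrite Rabs_Ropp, Rabs_mult.
    rewrite (Rmult_comm (B - 1)), Rmult_assoc, (Rmult_comm _ (B - 1)).
    apply Rmult_le_compat_l; assumption. }
  assert (Hxs : - (s * (x1 * x2)) <= Rabs x1 * Rabs x2).
  { eapply Rle_trans; [apply Rle_abs|].
    rewrite Rabs_Ropp, Rabs_mult, H12, (Rabs_pos_eq s) by lra.
    assert (0 <= Rabs x1 * Rabs x2) by (apply Rmult_le_pos; assumption). nra. }
  (* Young's inequality: [B|x1||x2| <= (ko/2) x1^2 + B^2/(2 ko) x2^2] *)
  assert (Hyoung : B * (Rabs x1 * Rabs x2)
    <= ko / 2 * x1 ^ 2 + B ^ 2 / (2 * ko) * x2 ^ 2).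
  { rewrite <- Q1, <- Q2.
    apply Rmult_le_reg_l with (2 * ko); [lra|].
    replace (2 * ko * (ko / 2 * Rabs x1 ^ 2 + B ^ 2 / (2 * ko) * Rabs x2 ^ 2))
      with (ko ^ 2 * Rabs x1 ^ 2 + B ^ 2 * Rabs x2 ^ 2) by (field; lra).
    pose proof (pow2_ge_0 (ko * Rabs x1 - B * Rabs x2)). nra. }
  (* After Young's inequality at least [ko / 2 * x1 ^ 2 + ko * x2 ^ 2] of damping remains, and
     [b * V] costs at most [ko / 2] times [|x|^2]. *)
  assert (Hbr : - (2 * A - 1) * x2 ^ 2 - k * x1 ^ 2 - s * (x1 * x2) - x1 * u <= - (b * V)).
  { pose proof (pow2_ge_0 x1). pose proof (pow2_ge_0 x2).
    assert (ko * x1 ^ 2 <= k * x1 ^ 2) by nra.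
    assert (Hx2 : (ko + B ^ 2 / (2 * ko)) * x2 ^ 2 <= (2 * A - 1) * x2 ^ 2).
    { apply Rmult_le_compat_r; lra. }
    nra. }
  assert (Hk' : A * dk * x1 ^ 2 <= 0).
  { pose proof (pow2_ge_0 x1). assert (A * dk <= 0) by nra. nra. }
  assert (HAu : 0 <= A * (x2 * u)) by (apply Rmult_le_pos; lra).
  apply (Rmult_le_compat_l s) in Hbr; [|lra].
  replace (A * dk * x1 ^ 2 + ds * (x1 * x2)
    + ((2 * (A * k) * x1 + s * x2) * x2
       + (2 * A * x2 + s * x1) * (- s * x2 - k * x1 - u)))
    with (A * dk * x1 ^ 2 + ds * (x1 * x2) - 2 * (A * (x2 * u))
          + s * (- (2 * A - 1) * x2 ^ 2 - k * x1 ^ 2 - s * (x1 * x2) - x1 * u)) by ring.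
  lra.
Qed.

(** * Lipschitz bounds and global trajectories of the friction field *)

Lemma exp_neg_le_1 (y : R) : y <= 0 -> exp y <= 1.
Proof. intros H. rewrite <- exp_0. apply exp_le_compat, H. Qed.

(** Product rule for differences: a factor bounded by 2 times the increment of [tanh], plus the
    increment of the exponential times [tanh], which is bounded by 1. *)
Lemma friction_field_component_lipschitz (mu : R -> R) (s2 s3 beta1 beta2 M y z : R) :
  0 < beta1 -> 0 < beta2 -> 0 < s2 <= 1 -> 0 < s3 <= 1 ->
  (forall y, 0 <= mu y) -> (forall y, ex_derive mu y) ->
  (forall y, Rabs (Derive mu y) <= M) ->
  Rabs ((s2 + s3 * exp (- beta1 * mu y)) * tanh (beta2 * y)
        - (s2 + s3 * exp (- beta1 * mu z)) * tanh (beta2 * z))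
  <= (2 * beta2 + beta1 * M) * Rabs (y - z).
Proof.
  intros Hb1 Hb2 Hs2 Hs3 Hmu Hd HM.
  assert (He : forall y, 0 < exp (- beta1 * mu y) <= 1).
  { intros v. split; [apply exp_pos|]. apply exp_neg_le_1. pose proof (Hmu v). nra. }
  assert (Helip : Rabs (exp (- beta1 * mu y) - exp (- beta1 * mu z))
                  <= beta1 * M * Rabs (y - z)).
  { apply (is_derive_lipschitz (fun v => exp (- beta1 * mu v))
      (fun v => - beta1 * Derive mu v * exp (- beta1 * mu v)) (beta1 * M)).
    - intros v. auto_derive; [apply Hd|].
      change (Derive (fun x => mu x)) with (Derive mu). ring.
    - intros v. rewrite !Rabs_mult, Rabs_Ropp, (Rabs_pos_eq beta1) by lra.
      rewrite (Rabs_pos_eq (exp _)) by (left; apply exp_pos).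
      pose proof (He v). pose proof (HM v). pose proof (Rabs_pos (Derive mu v)).
      assert (0 <= beta1 * Rabs (Derive mu v)) by nra.
      assert (beta1 * Rabs (Derive mu v) <= beta1 * M) by nra. nra. }
  assert (Htlip : Rabs (tanh (beta2 * y) - tanh (beta2 * z)) <= beta2 * Rabs (y - z)).
  { eapply Rle_trans; [apply tanh_lipschitz|].
    rewrite <- Rmult_minus_distr_l, Rabs_mult, (Rabs_pos_eq beta2) by lra. lra. }
  replace (_ - _) with
    ((s2 + s3 * exp (- beta1 * mu y)) * (tanh (beta2 * y) - tanh (beta2 * z))
     + s3 * (exp (- beta1 * mu y) - exp (- beta1 * mu z)) * tanh (beta2 * z)) by ring.
  eapply Rle_trans; [apply Rabs_triang|].
  rewrite !Rabs_mult, (Rabs_pos_eq s3) by lra.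
  pose proof (He y) as Hy. pose proof (tanh_abs_le_1 (beta2 * z)) as Hz.
  rewrite (Rabs_pos_eq (s2 + _)) by nra.
  pose proof (Rabs_pos (tanh (beta2 * z))).
  pose proof (Rabs_pos (tanh (beta2 * y) - tanh (beta2 * z))).
  pose proof (Rabs_pos (exp (- beta1 * mu y) - exp (- beta1 * mu z))).
  assert (s3 * exp (- beta1 * mu y) <= 1) by nra.
  assert (s3 * Rabs (exp (- beta1 * mu y) - exp (- beta1 * mu z)) * Rabs (tanh (beta2 * z))
    <= beta1 * M * Rabs (y - z)).
  { apply Rle_trans with (1 * Rabs (exp (- beta1 * mu y) - exp (- beta1 * mu z)) * 1); [|lra].
    apply Rmult_le_compat; try assumption; try nra. }
  assert ((s2 + s3 * exp (- beta1 * mu y)) * Rabs (tanh (beta2 * y) - tanh (beta2 * z))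
    <= 2 * (beta2 * Rabs (y - z))).
  { apply Rmult_le_compat; try assumption; try nra. }
  lra.
Qed.

Lemma abs_fst_le_norm (x : R * R) : Rabs (fst x) <= norm x.
Proof.
  apply Rsqr_incr_0_var; [|apply norm_ge_0].
  rewrite <- Rsqr_abs. unfold Rsqr. pose proof (norm_pair_sqr x).
  pose proof (pow2_ge_0 (snd x)). lra.
Qed.

Lemma abs_snd_le_norm (x : R * R) : Rabs (snd x) <= norm x.
Proof.
  apply Rsqr_incr_0_var; [|apply norm_ge_0].
  rewrite <- Rsqr_abs. unfold Rsqr. pose proof (norm_pair_sqr x).
  pose proof (pow2_ge_0 (fst x)). lra.
Qed.

Lemma norm_pair_le (x : R * R) : norm x <= Rabs (fst x) + Rabs (snd x).
Proof.
  pose proof (Rabs_pos (fst x)). pose proof (Rabs_pos (snd x)).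
  apply Rsqr_incr_0_var; [|lra].
  unfold Rsqr. pose proof (norm_pair_sqr x) as Hn.
  rewrite <- (pow2_abs (fst x)), <- (pow2_abs (snd x)) in Hn. nra.
Qed.

Lemma friction_field_lipschitz (sigma1 sigma2 sigma3 k mu : R -> R)
  (beta1 beta2 kbar M alpha : R) :
  0 < beta1 -> 0 < beta2 ->
  (forall t, 0 < sigma1 t <= 1) -> (forall t, 0 < sigma2 t <= 1) ->
  (forall t, 0 < sigma3 t <= 1) -> (forall t, 0 <= k t <= kbar) ->
  (forall y, 0 <= mu y) -> (forall y, ex_derive mu y) ->
  (forall y, Rabs (Derive mu y) <= M) ->
  forall x y t,
    norm (minus (friction_field sigma1 sigma2 sigma3 k mu beta1 beta2 alpha x t)
                (friction_field sigma1 sigma2 sigma3 k mu beta1 beta2 alpha y t))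
    <= (2 + kbar + (2 * beta2 + beta1 * M)) * norm (minus x y).
Proof.
  intros Hb1 Hb2 Hs1 Hs2 Hs3 Hk Hmu Hd HM [x1 x2] [y1 y2] t.
  eapply Rle_trans; [apply norm_pair_le|].
  pose proof (abs_fst_le_norm (minus (x1, x2) (y1, y2))) as N1.
  pose proof (abs_snd_le_norm (minus (x1, x2) (y1, y2))) as N2.
  set (N := norm (minus (x1, x2) (y1, y2))) in *.
  change (Rabs (x1 - y1) <= N) in N1. change (Rabs (x2 - y2) <= N) in N2.
  change (Rabs (fst (minus _ _))) with (Rabs (x2 - y2)).
  set (u := fun y => (sigma2 (t / alpha) + sigma3 (t / alpha) * exp (- beta1 * mu y))
              * tanh (beta2 * y)).
  change (Rabs (snd (minus _ _))) with
    (Rabs ((- sigma1 (t / alpha) * x2 - k t * x1 - u x2)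
           - (- sigma1 (t / alpha) * y2 - k t * y1 - u y2))).
  assert (Hu : Rabs (u x2 - u y2) <= (2 * beta2 + beta1 * M) * Rabs (x2 - y2)).
  { apply friction_field_component_lipschitz; auto. }
  replace (- sigma1 (t / alpha) * x2 - k t * x1 - u x2
           - (- sigma1 (t / alpha) * y2 - k t * y1 - u y2))
    with (- (sigma1 (t / alpha) * (x2 - y2)) + - (k t * (x1 - y1)) + - (u x2 - u y2)) by ring.
  pose proof (Rabs_triang (- (sigma1 (t / alpha) * (x2 - y2)) + - (k t * (x1 - y1)))
    (- (u x2 - u y2))) as T1.
  pose proof (Rabs_triang (- (sigma1 (t / alpha) * (x2 - y2))) (- (k t * (x1 - y1)))) as T2.
  specialize (Hs1 (t / alpha)). specialize (Hk t).
  rewrite Rabs_Ropp in T1. rewrite 2!Rabs_Ropp, 2!Rabs_mult in T2.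
    rewrite (Rabs_pos_eq (sigma1 _)), (Rabs_pos_eq (k t)) in T2 by lra.
  assert (HM0 : 0 <= M) by exact (Rle_trans _ _ _ (Rabs_pos _) (HM 0)).
  pose proof (Rabs_pos (x1 - y1)). pose proof (Rabs_pos (x2 - y2)).
  assert (sigma1 (t / alpha) * Rabs (x2 - y2) <= N) by nra.
  assert (k t * Rabs (x1 - y1) <= kbar * N) by nra.
  assert (0 <= 2 * beta2 + beta1 * M) by nra.
  assert ((2 * beta2 + beta1 * M) * Rabs (x2 - y2) <= (2 * beta2 + beta1 * M) * N) by nra.
  lra.
Qed.

Lemma friction_field_continuous (sigma1 sigma2 sigma3 k mu : R -> R)
  (beta1 beta2 alpha : R) (x : R * R) (t : R) :
  (forall t, continuous sigma1 t) -> (forall t, continuous sigma2 t) ->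
  (forall t, continuous sigma3 t) -> continuous k t ->
  continuous (friction_field sigma1 sigma2 sigma3 k mu beta1 beta2 alpha x) t.
Proof.
  intros H1 H2 H3 Hk. destruct x as [x1 x2]. unfold friction_field.
  assert (Hd : continuous (fun t => t / alpha) t).
  { apply continuous_Rmult; [apply continuous_id|apply continuous_const]. }
  assert (Hs : forall s : R -> R, (forall t, continuous s t) ->
    continuous (fun t => s (t / alpha)) t).
  { intros s Hc. apply (continuous_comp (fun t => t / alpha) s); [exact Hd|apply Hc]. }
  assert (Hm : forall (f : R -> R) c, continuous f t -> continuous (fun t => f t * c) t).
  { intros f c Hf. apply continuous_Rmult; [exact Hf|apply continuous_const]. }
  assert (Ho : forall (f : R -> R), continuous f t -> continuous (fun t => - f t) t).
  { intros f Hf. apply (continuous_opp (V := R_NormedModule)). exact Hf. }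
  apply continuous_pair; [apply continuous_const|].
  apply (continuous_Rplus (fun t => - sigma1 (t / alpha) * x2 - k t * x1)).
  - apply (continuous_Rplus (fun t => - sigma1 (t / alpha) * x2)).
    + apply (Hm (fun t => - sigma1 (t / alpha))), (Ho (fun t => sigma1 (t / alpha))), Hs, H1.
    + apply (Ho (fun t => k t * x1)), Hm, Hk.
  - apply (Ho (fun t => _ * tanh (beta2 * x2))), Hm.
    apply (continuous_Rplus (fun t => sigma2 (t / alpha))); [apply Hs, H2|].
    apply (Hm (fun t => sigma3 (t / alpha))), Hs, H3.
Qed.

(** Holding [k] at [k 0] for negative times gives a field that is Lipschitz and continuous at all
    times and unchanged where the trajectory lives. *)
Lemma friction_field_trajectory (sigma1 sigma2 sigma3 k mu : R -> R)
  (beta1 beta2 kbar M alpha to : R) (xo : R * R) :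
  0 < beta1 -> 0 < beta2 ->
  (forall t, 0 < sigma1 t <= 1) -> (forall t, 0 < sigma2 t <= 1) ->
  (forall t, 0 < sigma3 t <= 1) -> (forall t, 0 <= t -> 0 <= k t <= kbar) ->
  (forall t, continuous sigma1 t) -> (forall t, continuous sigma2 t) ->
  (forall t, continuous sigma3 t) -> continuous_on (fun t => 0 <= t) k ->
  (forall y, 0 <= mu y) -> (forall y, ex_derive mu y) ->
  (forall y, Rabs (Derive mu y) <= M) -> 0 <= to ->
  exists phi,
    is_trajectory (friction_field sigma1 sigma2 sigma3 k mu beta1 beta2 alpha) to xo phi.
Proof.
  intros Hb1 Hb2 Hs1 Hs2 Hs3 Hk Hc1 Hc2 Hc3 Hck Hmu Hd HM Hto.
  set (h := friction_field sigma1 sigma2 sigma3 (fun t => k (Rmax 0 t)) mu beta1 beta2 alpha).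
  set (L := 2 + kbar + (2 * beta2 + beta1 * M)).
  assert (HM0 : 0 <= M) by exact (Rle_trans _ _ _ (Rabs_pos _) (HM 0)).
  pose proof (Hk 0 (Rle_refl 0)) as Hk0.
  assert (HL : 0 < L) by (unfold L; nra).
  assert (Hlip : forall x y t, norm (minus (h x t) (h y t)) <= L * norm (minus x y)).
  { apply friction_field_lipschitz; auto. intros t. apply Hk, Rmax_l. }
  (* The origin is an equilibrium, so the Lipschitz bound against it controls the field at [xo]
     uniformly in time. The complex numbers have carrier [R * R] and provide the completeness. *)
  destruct (lipschitz_global_solution (V := C_R_CompleteNormedModule)
    h L (L * norm (minus xo zero)) to xo HL Hlip) as [phi [Hphi0 Hphi]].
  - intros x t. apply friction_field_continuous; auto.
    apply (continuous_extension 0 k Hck).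
  - intros t.
    replace (h xo t) with (minus (h xo t) (h zero t)); [apply Hlip|].
    replace (h zero t) with (zero : R * R);
      [apply (minus_zero_r (G := prod_AbelianGroup R_AbelianGroup R_AbelianGroup))|].
    apply injective_projections; simpl; unfold zero; simpl;
      rewrite ?Rmult_0_r, ?tanh_0; ring.
  - exists phi. split; [exact Hphi0|].
    intros t Ht. apply (filterdiff_within _ _ phi); [exact Ht|reflexivity|].
    replace (friction_field sigma1 sigma2 sigma3 k mu beta1 beta2 alpha (phi t) t)
      with (h (phi t) t); [apply Hphi, Ht|].
    unfold h, friction_field. rewrite Rmax_right by lra. reflexivity.
Qed.

(** * The exponentially weighted form and its decay rate *)

(** Here [e] is the logarithmic derivative of the weight. Keeping [G] as a factor lets it be pulled
    out of the form, so that weighting merely adds [e] to the rate. *)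
Lemma is_derive_mult_growth (f df G e : R -> R) (t : R) :
  is_derive f t (df t) -> is_derive G t (G t * e t) ->
  is_derive (fun s => f s * G s) t ((df t + f t * e t) * G t).
Proof.
  intros Hf HG.
  replace ((df t + f t * e t) * G t) with (df t * G t + f t * (G t * e t)) by ring.
  apply (is_derive_mult (K := R_AbsRing) f G t (df t) (G t * e t) Hf HG).
  apply Rmult_comm.
Qed.

Lemma quad_scale (g a b c : R) (x : R * R) :
  quad (a * g) (b * g) (c * g) x = g * quad a b c x.
Proof. unfold quad. ring. Qed.

Theorem corollary16
  (sigma1 sigma2 sigma3 k dk mu : R -> R)
  (beta1 beta2 ko kbar cb T : R)
  (hbeta1 : 0 < beta1) (hbeta2 : 0 < beta2)
  (hsigma1 : forall t, 0 < sigma1 t <= 1)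
  (hsigma2 : forall t, 0 < sigma2 t <= 1)
  (hsigma3 : forall t, 0 < sigma3 t <= 1)
  (hsigma1_C1 : C1_bounded_derivative sigma1)
  (hsigma2_C1 : C1_bounded_derivative sigma2)
  (hsigma3_C1 : C1_bounded_derivative sigma3)
  (hk_pos : forall t, 0 <= t -> 0 < k t)
  (hk_C1 : C1_halfline k dk)
  (hdk_bounded : exists M, forall t, 0 <= t -> Rabs (dk t) <= M)
  (hko : 0 < ko) (hkbar : 0 < kbar)
  (hk_bounds : forall t, 0 <= t -> ko <= k t <= kbar)
  (hdk_nonpos : forall t, 0 <= t -> dk t <= 0)
  (hmu_nonneg : forall y, 0 <= mu y)
  (hmu_zero : forall y, mu y = 0 <-> y = 0)
  (hmu_derivable : forall y, ex_derive mu y)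
  (hmu_bounded : exists M, forall y, Rabs (Derive mu y) <= M)
  (hcb : 0 < cb) (hT : 0 < T)
  (hexcitation : forall t, 0 <= t -> cb <= RInt sigma1 (t - T) t) :
  exists alpha_o : R, 0 < alpha_o /\
    forall alpha : R, alpha_o < alpha ->
      UGAS (friction_field sigma1 sigma2 sigma3 k mu beta1 beta2 alpha) /\
      is_Lyapunov (friction_field sigma1 sigma2 sigma3 k mu beta1 beta2 alpha)
        (V_alpha sigma1 sigma2 sigma3 k ko kbar beta2 T alpha).
Proof.
  assert (Hcont : forall f : R -> R, C1_bounded_derivative f -> forall t, continuous f t).
  { intros f [Hf _] t. apply (ex_derive_continuous (V := R_NormedModule)), Hf. }
  pose proof (Hcont _ hsigma1_C1) as Hc1.
  pose proof (Hcont _ hsigma2_C1) as Hc2.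
  pose proof (Hcont _ hsigma3_C1) as Hc3. clear Hcont.
  destruct hsigma1_C1 as [Hd1 [Hdc1 [M1 HM1]]].
  destruct hmu_bounded as [Mmu HMmu].
  destruct hk_C1 as [Hk Hdk].
  assert (HM10 : 0 <= M1) by exact (Rle_trans _ _ _ (Rabs_pos _) (HM1 0)).
  destruct (A_const_bounds ko beta2 hko hbeta2) as [HA1 [HA2 HA3]].
  set (b := b_bar ko kbar beta2).
  set (A := A_const ko beta2) in *.
  assert (HAk : 0 < A ^ 2 * kbar) by (apply Rmult_lt_0_compat; nra).
  assert (Hb : 0 < b) by (apply Rdiv_lt_0_compat; fold A; lra).
  (* This relation to the upper bound of the form dictates the value of [b_bar]. *)
  assert (HbA : b * (2 * A ^ 2 * kbar) = ko / 2).
  { unfold b, b_bar. fold A. field. split; nra. }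
  assert (Hbcb : 0 < b * cb) by (apply Rmult_lt_0_compat; assumption).
  (* Half of the averaged rate [b * cb / T]; the other half pays for the slow drift of [sigma1]. *)
  set (lam := b * cb / (2 * T)).
  assert (Hlam : 0 < lam) by (apply Rdiv_lt_0_compat; lra).
  (* Beyond [M1 / lam] the drift [M1 / alpha] is at most [lam]; the 1 keeps the threshold positive
     when [M1 = 0]. *)
  exists (1 + M1 / lam).
  assert (HMl : 0 <= M1 / lam) by (apply Rdiv_le_0_compat; lra).
  split; [lra|]. intros alpha Halpha.
  assert (Ha : 0 < alpha) by lra.
  assert (Hta : forall t, 0 <= t -> 0 <= t / alpha).
  { intros t Ht. apply Rdiv_le_0_compat; assumption. }
  set (K := fun s => plus (k (Rmax 0 s)) (scal (Rmin 0 s - 0) (dk 0))).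
  assert (HK : forall t, is_derive K t (dk (Rmax 0 t))).
  { apply (derive_within_extension 0 k dk). exact Hk. }
  assert (HKk : forall t, 0 <= t -> K t = k t).
  { intros t Ht. unfold K. rewrite Rmax_right, Rmin_left by assumption.
    change (k t + (0 - 0) * dk 0 = k t). ring. }
  set (E := fun r => RInt (fun s => RInt sigma1 s r) (r - T) r).
  set (I := fun r => RInt sigma1 (r - T) r).
  assert (HE : forall r, is_derive E r (T * sigma1 r - I r)).
  { intros r. exact (is_derive_double_integral sigma1 T r Hc1). }
  set (G := fun t => exp (alpha * b / T * E (t / alpha))).
  (* Logarithmic derivative of [G]: the prefactor [alpha] in the exponent cancels the [1 / alpha] of
     the chain rule. *)
  set (e := fun t => b * sigma1 (t / alpha) - b / T * I (t / alpha)).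
  assert (HG : forall t, is_derive G t (G t * e t)).
  { intros t. unfold G. auto_derive.
    - eexists. apply HE.
    - change (Derive (fun x => E x)) with (Derive E).
      rewrite (is_derive_unique E _ _ (HE _)). unfold e, Rdiv. field. lra. }
  assert (HG1 : forall t, 1 <= G t <= exp (alpha * b / T * (T * T))).
  { intros t.
    assert (HE0 : 0 <= E (t / alpha) <= T * T).
    { apply (double_integral_bounds sigma1 T (t / alpha) (Rlt_le _ _ hT) Hc1 hsigma1). }
    assert (Hp : 0 < alpha * b / T).
    { apply Rdiv_lt_0_compat; [apply Rmult_lt_0_compat; assumption|assumption]. }
    split.
    - rewrite <- exp_0. apply exp_le_compat. apply Rmult_le_pos; lra.
    - apply exp_le_compat. apply Rmult_le_compat_l; lra. }
  set (s := fun t => sigma1 (t / alpha)).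
  set (ds := fun t => Derive sigma1 (t / alpha) / alpha).
  assert (Hs : forall t, is_derive s t (ds t)).
  { intros t. unfold s, ds. auto_derive; [apply Hd1|].
    change (Derive (fun x => sigma1 x)) with (Derive sigma1). unfold Rdiv. ring. }
  set (f := fun t => A * K t). set (df := fun t => A * dk (Rmax 0 t)).
  assert (Hf : forall t, is_derive f t (df t)).
  { intros t. apply (is_derive_scal K t A), HK. }
  assert (HA : forall t, is_derive (fun _ : R => A) t 0).
  { intros t. apply (is_derive_const (K := R_AbsRing) (V := R_NormedModule)). }
  assert (Hcd : forall u du : R -> R, (forall t, is_derive u t (du t)) ->
    forall t, continuous u t).
  { intros u du Hu t. apply (ex_derive_continuous (V := R_NormedModule)).
    eexists. apply Hu. }
  assert (Hdiv : forall u : R -> R, (forall t, continuous u t) ->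
    forall t, continuous (fun t => u (t / alpha)) t).
  { intros u Hu t. apply (continuous_comp (fun t => t / alpha) u); [|apply Hu].
    apply continuous_Rmult; [apply continuous_id|apply continuous_const]. }
  assert (Hec : forall t, continuous e t).
  { intros t. apply (continuous_minus (V := R_NormedModule)
      (fun t => b * sigma1 (t / alpha)) (fun t => b / T * I (t / alpha))).
    - apply continuous_Rmult; [apply continuous_const|apply Hdiv, Hc1].
    - apply continuous_Rmult; [apply continuous_const|apply Hdiv].
      apply (Hcd I (fun r => sigma1 r - sigma1 (r - T))).
      intros r. exact (is_derive_sliding_integral sigma1 T r Hc1). }
  assert (Hgc : forall u du : R -> R, (forall t, is_derive u t (du t)) ->
    (forall t, continuous du t) ->
    forall t, continuous (fun t => (du t + u t * e t) * G t) t).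
  { intros u du Hu Hdu t.
    apply continuous_Rmult; [|apply (Hcd G (fun t => G t * e t) HG)].
    apply (continuous_Rplus du); [apply Hdu|].
    apply continuous_Rmult; [apply (Hcd u du Hu)|apply Hec]. }
  assert (Hdfc : forall t, continuous df t).
  { intros t. apply continuous_Rmult; [apply continuous_const|].
    apply (continuous_extension 0 dk Hdk). }
  assert (Hdsc : forall t, continuous ds t).
  { intros t. apply continuous_Rmult; [apply (Hdiv _ Hdc1)|apply continuous_const]. }
  set (h := friction_field sigma1 sigma2 sigma3 k mu beta1 beta2 alpha).
  (* The weight enters the upper bound, which thus grows with [alpha]; the rate [lam] does not
     depend on [alpha]. *)
  set (Kmax := 2 * A ^ 2 * kbar * exp (alpha * b / T * (T * T))).
  assert (HKmax : 0 < Kmax) by (apply Rmult_lt_0_compat; [lra|apply exp_pos]).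
  assert (Hquad : forall x t, 0 <= t ->
    / 2 * norm x ^ 2 <= quad (f t) A (s t) x <= 2 * A ^ 2 * kbar * norm x ^ 2).
  { intros x t Ht. rewrite norm_pair_sqr. unfold quad, f. rewrite HKk by assumption.
    apply quadratic_bounds with ko; auto. apply hsigma1. }
  assert (Hbd : forall x t, 0 <= t ->
    / 2 * norm x ^ 2 <= quad (f t * G t) (A * G t) (s t * G t) x <= Kmax * norm x ^ 2).
  { intros x t Ht. rewrite quad_scale. specialize (HG1 t). specialize (Hquad x t Ht).
    pose proof (pow2_ge_0 (norm x)). split.
    - nra.
    - apply Rle_trans with (G t * (2 * A ^ 2 * kbar * norm x ^ 2)).
      + apply Rmult_le_compat_l; lra.
      + unfold Kmax. assert (0 <= 2 * A ^ 2 * kbar * norm x ^ 2) by nra. nra. }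
  assert (Hdec : forall x t, 0 <= t ->
    quad ((df t + f t * e t) * G t) ((0 + A * e t) * G t) ((ds t + s t * e t) * G t) x
      + dot (quad_grad (f t * G t) (A * G t) (s t * G t) x) (h x t)
    <= - lam * quad (f t * G t) (A * G t) (s t * G t) x).
  { intros x t Ht. rewrite !quad_scale.
    pose proof (HG1 t) as HGt. specialize (Hquad x t Ht).
    pose proof (pow2_ge_0 (norm x)) as Hn.
    set (S := sigma2 (t / alpha) + sigma3 (t / alpha) * exp (- beta1 * mu (snd x))).
    (* With the slope bound on [tanh] this makes the friction at most [2 * beta2 * |x2|], that is,
       [B - 1] times [|x2|]. *)
    assert (HS : 0 <= S <= 2).
    { unfold S. pose proof (hsigma2 (t / alpha)). pose proof (hsigma3 (t / alpha)).
      pose proof (exp_pos (- beta1 * mu (snd x))).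
      assert (exp (- beta1 * mu (snd x)) <= 1).
      { apply exp_neg_le_1. pose proof (hmu_nonneg (snd x)). nra. }
      nra. }
    destruct (tanh_sector (beta2 * snd x)) as [Ht1 Ht2].
    assert (Hdiss : quad (df t) 0 (ds t) x + dot (quad_grad (f t) A (s t) x) (h x t)
      <= (M1 / alpha - b * s t) * quad (f t) A (s t) x).
    { pose proof (dissipation A (1 + 2 * beta2) b ko kbar (k t) (dk t) (s t) (ds t)
        (M1 / alpha) (S * tanh (beta2 * snd x)) (fst x) (snd x)) as HD.
      unfold f, df, quad. rewrite HKk, Rmax_right by assumption.
      replace (_ + _) with (A * dk t * fst x ^ 2 + ds t * (fst x * snd x)
        + ((2 * (A * k t) * fst x + s t * snd x) * snd x
           + (2 * A * snd x + s t * fst x)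
             * (- s t * snd x - k t * fst x - S * tanh (beta2 * snd x)))).
      2:{ unfold dot, quad_grad, h, S. destruct x as [x1 x2]. simpl. fold (s t). ring. }
      apply HD; auto; try lra.
      - apply hsigma1.
      - unfold ds, Rdiv. rewrite Rabs_mult, (Rabs_pos_eq (/ alpha))
          by (left; apply Rinv_0_lt_compat, Ha).
        apply Rmult_le_compat_r; [left; apply Rinv_0_lt_compat, Ha|apply HM1].
      - assert (0 <= snd x * tanh (beta2 * snd x)) by nra. nra.
      - rewrite Rabs_mult, (Rabs_pos_eq S) by lra.
        rewrite Rabs_mult, (Rabs_pos_eq beta2) in Ht2 by lra.
        pose proof (Rabs_pos (tanh (beta2 * snd x))). nra. }
    set (V := quad (f t) A (s t) x) in *.
    assert (HV : 0 <= V) by lra.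
    assert (HMa : M1 / alpha <= lam).
    { apply Rmult_le_reg_l with alpha; [assumption|].
      replace (alpha * (M1 / alpha)) with (lam * (M1 / lam)) by (field; lra).
      rewrite (Rmult_comm alpha). apply Rmult_le_compat_l; lra. }
    assert (He : e t <= b * s t - 2 * lam).
    { unfold e, lam, s. pose proof (hexcitation (t / alpha) (Hta t Ht)) as HI.
      change (cb <= I (t / alpha)) in HI.
      replace (2 * (b * cb / (2 * T))) with (b / T * cb) by (field; lra).
      assert (0 < b / T) by (apply Rdiv_lt_0_compat; assumption). nra. }
    assert (Heq : G t * quad (df t + f t * e t) (0 + A * e t) (ds t + s t * e t) x
        + dot (quad_grad (f t * G t) (A * G t) (s t * G t) x) (h x t)
      = G t * (quad (df t) 0 (ds t) x + dot (quad_grad (f t) A (s t) x) (h x t) + e t * V)).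
    { unfold V, quad, quad_grad, dot. simpl. ring. }
    rewrite Heq.
    replace (- lam * (G t * V)) with (G t * (- lam * V)) by ring.
    apply Rmult_le_compat_l; [lra|]. nra. }
  assert (HaG : forall t, is_derive (fun t => f t * G t) t ((df t + f t * e t) * G t)).
  { intros t. apply is_derive_mult_growth; auto. }
  assert (HbG : forall t, is_derive (fun t => A * G t) t ((0 + A * e t) * G t)).
  { intros t. apply (is_derive_mult_growth (fun _ => A) (fun _ => 0)); auto. }
  assert (HcG : forall t, is_derive (fun t => s t * G t) t ((ds t + s t * e t) * G t)).
  { intros t. apply is_derive_mult_growth; auto. }
  split.
  - apply (quad_UGAS h _ _ _ _ _ _ (/ 2) Kmax lam) with (2 := HKmax) (3 := Hlam)
      (4 := HaG) (5 := HbG) (6 := HcG); auto; [lra|].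
    intros xo to Hto. apply friction_field_trajectory with kbar Mmu; auto.
    + intros t Ht. specialize (hk_bounds t Ht). lra.
    + apply (continuous_on_ext _ K); [exact HKk|].
      apply continuous_on_forall. intros t _. apply (Hcd K _ HK).
  - apply (quad_is_Lyapunov h _ _ _ _ _ _ _ (/ 2) Kmax lam) with (4 := HaG) (6 := HbG)
      (8 := HcG); auto; try lra.
    + apply (Hgc (fun _ => A) (fun _ => 0) HA). intros t. apply continuous_const.
    + intros [x1 x2] t Ht. unfold V_alpha, V_frozen. fold b. fold A.
      change (exp _) with (G t). unfold quad, f, s. rewrite HKk by assumption.
      simpl. ring.
Qed.
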